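(* Let $0<q<1$. For each $n\in\mathbb{Z}$, the line bundle $\mathcal{L}_n$ over $\mathbb{C}P^1_q$ carries infinitely many holomorphic structures, no two of which are gauge equivalent.
   Context: Algebras. $\mathcal{A}(SU_q(2))$ is the unital $*$-algebra generated by $a,c$ with relations $ac=qca$, $ac^*=qc^*a$, $cc^*=c^*c$, $a^*a+c^*c=aa^*+q^2cc^*=1$. It is a Hopf $*$-algebra with coproduct $\Delta(a)=a\otimes a-qc^*\otimes c$, $\Delta(c)=c\otimes a+a^*\otimes c$. $\mathcal{A}(\mathbb{C}P^1_q)$ is the unital $*$-subalgebra generated by $B_-=ac^*$, $B_+=ca^*=B_-^*$, $B_0=cc^*$. For $n\in\mathbb{Z}$, $\mathcal{L}_n\subset\mathcal{A}(SU_q(2))$ is the $\mathcal{A}(\mathbb{C}P^1_q)$-sub-bimodule generated by $\{(c^* )^m(a^* )^{n-m}:0\le m\le n\}$ if $n\ge 0$ and by $\{c^ma^{-n-m}:0\le m\le -n\}$ if $n\le 0$; $\mathcal{L}_0=\mathcal{A}(\mathbb{C}P^1_q)$ and multiplication induces $\mathcal{L}_m\otimes_{\mathcal{A}(\mathbb{C}P^1_q)}\mathcal{L}_n\cong\mathcal{L}_{m+n}$. Forms. $\mathcal{A}(SU_q(2))\omega_-$ is the free left module on one generator $\omega_-$, made a bimodule by $\omega_-a=q^{-1}a\omega_-$, $\omega_-c=q^{-1}c\omega_-$, $\omega_-a^*=qa^*\omega_-$, $\omega_-c^*=qc^*\omega_-$ (so $\omega_-$ commutes with $\mathcal{A}(\mathbb{C}P^1_q)$).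 Put $\Omega^{0,1}=\Omega^{0,1}(\mathbb{C}P^1_q)=\mathcal{L}_{-2}\omega_-$. Let $D:\mathcal{A}(SU_q(2))\to\mathcal{A}(SU_q(2))\omega_-$ be the derivation with $D(a)=D(c)=0$, $D(a^* )=q^{1/2}c\,\omega_-$, $D(c^* )=-q^{-1/2}a\,\omega_-$. Its restriction to $\mathcal{A}(\mathbb{C}P^1_q)$ is $\bar\partial:\mathcal{A}(\mathbb{C}P^1_q)\to\Omega^{0,1}$; thus $\bar\partial B_0=-q^{-1/2}ca\,\omega_-$, $\bar\partial B_+=q^{1/2}c^2\omega_-$, $\bar\partial B_-=-q^{-1/2}a^2\omega_-$. Connections. A (left) $\bar\partial$-connection on $\mathcal{L}_n$ is a linear map $\overline\nabla:\mathcal{L}_n\to\Omega^{0,1}\otimes_{\mathcal{A}(\mathbb{C}P^1_q)}\mathcal{L}_n$ with $\overline\nabla(fs)=\bar\partial(f)\otimes s+f\overline\nabla(s)$ for $f\in\mathcal{A}(\mathbb{C}P^1_q)$, $s\in\mathcal{L}_n$. A holomorphic structure on $\mathcal{L}_n$ is a flat left $\bar\partial$-connection; flatness is automatic since there are no $(0,2)$-forms. The multiplication maps $\mathcal{L}_n\otimes\Omega^{0,1}\to\mathcal{L}_{n-2}\omega_-$ and $\Omega^{0,1}\otimes\mathcal{L}_n\to\mathcal{L}_{n-2}\omega_-$ (products in $\mathcal{A}(SU_q(2))\omega_-$) are isomorphisms, and $\Phi_{(n)}:\mathcal{L}_n\otimes\Omega^{0,1}\to\Omega^{0,1}\otimes\mathcal{L}_n$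 is the first followed by the inverse of the second. The standard $\bar\partial$-connection $\overline\nabla^{(n)}$ is $D|_{\mathcal{L}_n}:\mathcal{L}_n\to\mathcal{L}_{n-2}\omega_-\cong\Omega^{0,1}\otimes\mathcal{L}_n$. Every $\bar\partial$-connection on $\mathcal{L}_n$ has the form $\overline\nabla_\theta(s)=\overline\nabla^{(n)}(s)-\Phi_{(n)}(s\otimes\theta)$ for a unique $\theta\in\Omega^{0,1}$. Completions. $\mathcal{C}(SU_q(2))$ is the universal $C^*$-algebra generated by $a,c$ subject to the relations $ac=qca$, $ac^*=qc^*a$, $cc^*=c^*c$, $a^*a+c^*c=aa^*+q^2cc^*=1$, $h$ its unique left-invariant state (Haar state), $L^2(SU_q(2))$ the GNS space of $h$, $\mathcal{C}(\mathbb{C}P^1_q)$ the $C^*$-subalgebra generated by $1,B_0,B_\pm$, and $L^2(\mathbb{C}P^1_q)$ the closure of $\mathcal{A}(\mathbb{C}P^1_q)$ in $L^2(SU_q(2))$. $L^2(\Omega^{0,1})$ is the closure of $\mathcal{L}_{-2}$ in $L^2(SU_q(2))$, with $x\omega_-$ identified with $x$. The operator $\bar\partial$ is closable from $L^2(\mathbb{C}P^1_q)$ to $L^2(\Omega^{0,1})$; its closure is also denoted $\bar\partial$, with domain $\mathrm{Dom}(\bar\partial)$. Gauge equivalence. $\overline\nabla_{\theta_1}$ and $\overline\nabla_{\theta_2}$ on $\mathcal{L}_n$ are gauge equivalent if there is an invertible $g\in\mathcal{C}(\mathbb{C}P^1_q)$ with $g,g^{-1}\in\mathrm{Dom}(\bar\partial)$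 and $\theta_1=g\theta_2g^{-1}-\bar\partial(g)g^{-1}$, i.e. $\bar\partial(g)=g\theta_2-\theta_1g$. *)

(* Defs.v *)
From HB Require Import structures.
From mathcomp Require Import all_boot all_order all_algebra complex.
From mathcomp Require Import generic_quotient all_classical all_reals.
From mathcomp Require Import topology normedtype sequences ring.
Set Implicit Arguments.
Unset Strict Implicit.
Unset Printing Implicit Defensive.
Import Order.TTheory GRing.Theory Num.Theory numFieldNormedType.Exports.
Local Open Scope ring_scope.
Local Open Scope classical_set_scope.
Local Open Scope complex_scope.
Local Open Scope quotient_scope.

HB.mixin Record Algebra_isStar (K : numClosedFieldType) A
    of GRing.Algebra K A := {
  star : A -> A;
  starK : involutive star;
  starD : {morph star : x y / x + y};
  starZ : forall (l : K) (x : A), star (l *: x) = Num.conj l *: star x;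
  starM : forall x y : A, star (x * y) = star y * star x
}.

#[short(type="starAlgType")]
HB.structure Definition StarAlgebra (K : numClosedFieldType) :=
  {A of GRing.Algebra K A & Algebra_isStar K A}.

(* The norm is a separate real-valued function: Hierarchy Builder admits no
   join of the existing structures of rings and of normed modules other than
   numDomainType. *)
HB.mixin Record StarAlgebra_isCstar (R : realType) A of StarAlgebra R[i] A := {
  cnorm : A -> R;
  cnorm_eq0 : forall x, cnorm x = 0 -> x = 0;
  cnormZ : forall (l : R[i]) (x : A), cnorm (l *: x) = Normc.normc l * cnorm x;
  cnormD : forall x y, cnorm (x + y) <= cnorm x + cnorm y;
  cnormM : forall x y : A, cnorm (x * y) <= cnorm x * cnorm y;
  cnorm_star : forall x : A, cnorm (star x * x) = cnorm x ^+ 2;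
  cnorm_complete : forall u : nat -> A,
    (forall e, 0 < e -> exists N, forall m n, (N <= m)%N -> (N <= n)%N ->
       cnorm (u m - u n) < e) ->
    exists l, (fun n => cnorm (u n - l)) @ \oo --> (0 : R)
}.

#[short(type="cstarAlgType")]
HB.structure Definition CstarAlgebra (R : realType) :=
  {A of StarAlgebra R[i] A & StarAlgebra_isCstar R A}.

Definition star_morph (K : numClosedFieldType) (A B : starAlgType K)
  (f : A -> B) := forall x, f (star x) = star (f x).

Definition star_subalg (K : numClosedFieldType) (A : starAlgType K)
    (S : set A) :=
  [/\ S 1,
      forall x y, S x -> S y -> S (x + y),
      forall l x, S x -> S (l *: x),
      forall x y, S x -> S y -> S (x * y)
    & forall x, S x -> S (star x)].

Definition cnorm_closed (R : realType) (A : cstarAlgType R) (S : set A) :=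
  forall x, (forall e, 0 < e -> exists2 y, S y & cnorm (x - y) < e) -> S x.

Section SUq2.
Variables (R : realType) (q : R).
Local Notation C := (R[i]).
Local Notation Q := (q%:C).

Definition suq2_rel (B : starAlgType C) (a c : B) :=
  [/\ a * c = Q *: (c * a),
      a * star c = Q *: (star c * a),
      c * star c = star c * c,
      star a * a + star c * c = 1
    & a * star a + Q ^+ 2 *: (c * star c) = 1].

(* suq2 below is the unital algebra generated by a, a^*, c, c^* modulo the
   relations of suq2_rel and their adjoints, as a quotient of words. *)
Variant gen := Ga | Gas | Gc | Gcs.

Inductive word :=
  | WGen of gen
  | WCst of C
  | WAdd of word & word
  | WMul of word & word.

Definition WScal (l : C) (t : word) := WMul (WCst l) t.

Definition gen_star (x : gen) :=
  match x with Ga => Gas | Gas => Ga | Gc => Gcs | Gcs => Gc end.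

Fixpoint wstar (t : word) : word :=
  match t with
  | WGen x => WGen (gen_star x)
  | WCst l => WCst (Num.conj l)
  | WAdd u v => WAdd (wstar u) (wstar v)
  | WMul u v => WMul (wstar v) (wstar u)
  end.

Local Notation wa := (WGen Ga).
Local Notation was := (WGen Gas).
Local Notation wc := (WGen Gc).
Local Notation wcs := (WGen Gcs).
Local Infix "+++" := WAdd (at level 50, left associativity).
Local Infix "***" := WMul (at level 40, left associativity).

Variant word_rel : word -> word -> Prop :=
  | Rac : word_rel (wa *** wc) (WScal Q (wc *** wa))
  | Rac' : word_rel (wcs *** was) (WScal Q (was *** wcs))
  | Racs : word_rel (wa *** wcs) (WScal Q (wcs *** wa))
  | Racs' : word_rel (wc *** was) (WScal Q (was *** wc))
  | Rccs : word_rel (wc *** wcs) (wcs *** wc)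
  | Raa : word_rel (was *** wa +++ wcs *** wc) (WCst 1)
  | Raas : word_rel (wa *** was +++ WScal (Q ^+ 2) (wc *** wcs)) (WCst 1).

Inductive weq : word -> word -> Prop :=
  | weq_rel u v : word_rel u v -> weq u v
  | weq_refl u : weq u u
  | weq_sym u v : weq u v -> weq v u
  | weq_trans u v w : weq u v -> weq v w -> weq u w
  | weq_add u u' v v' : weq u u' -> weq v v' -> weq (u +++ v) (u' +++ v')
  | weq_mul u u' v v' : weq u u' -> weq v v' -> weq (u *** v) (u' *** v')
  | weq_addC u v : weq (u +++ v) (v +++ u)
  | weq_addA u v w : weq (u +++ (v +++ w)) (u +++ v +++ w)
  | weq_add0 u : weq (WCst 0 +++ u) u
  | weq_addN u : weq (WScal (-1) u +++ u) (WCst 0)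
  | weq_mulA u v w : weq (u *** (v *** w)) (u *** v *** w)
  | weq_mul1 u : weq (WCst 1 *** u) u
  | weq_mulDl u v w : weq ((u +++ v) *** w) (u *** w +++ v *** w)
  | weq_mulDr u v w : weq (u *** (v +++ w)) (u *** v +++ u *** w)
  | weq_cstD k l : weq (WCst (k + l)) (WCst k +++ WCst l)
  | weq_cstM k l : weq (WCst (k * l)) (WCst k *** WCst l)
  | weq_cstC k u : weq (WCst k *** u) (u *** WCst k).

HB.instance Definition _ := gen_eqMixin word.
HB.instance Definition _ := gen_choiceMixin word.

Definition weqb : rel word := fun u v => `[< weq u v >].

Lemma weqb_refl : reflexive weqb.
Proof. by move=> u; apply/asboolP/weq_refl. Qed.
Lemma weqb_sym : symmetric weqb.
Proof. by move=> u v; apply/asboolP/asboolP => /weq_sym. Qed.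
Lemma weqb_trans : transitive weqb.
Proof.
by move=> v u w /asboolP uv /asboolP vw; apply/asboolP/(weq_trans uv vw).
Qed.

Canonical weqb_equiv := EquivRel weqb weqb_refl weqb_sym weqb_trans.

Definition suq2 : Type := {eq_quot weqb}.
HB.instance Definition _ := Choice.on suq2.

Definition cls (t : word) : suq2 := \pi_{eq_quot weqb} t.
Definition rep (x : suq2) : word := repr (x : {eq_quot weqb}).

Lemma repK x : cls (rep x) = x.
Proof. exact: reprK. Qed.

Lemma clsP u v : weq u v <-> cls u = cls v.
Proof.
by split=> [uv|/eqmodP/asboolP //]; apply/eqmodP/asboolP.
Qed.

Lemma rep_cls t : weq (rep (cls t)) t.
Proof. by apply/clsP; rewrite repK. Qed.

Definition suq2_add x y := cls (WAdd (rep x) (rep y)).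
Definition suq2_mul x y := cls (WMul (rep x) (rep y)).
Definition suq2_scale l x := cls (WScal l (rep x)).
Definition suq2_opp x := cls (WScal (-1) (rep x)).

Lemma suq2_addE u v : suq2_add (cls u) (cls v) = cls (WAdd u v).
Proof. by apply/clsP/weq_add; apply: rep_cls. Qed.
Lemma suq2_mulE u v : suq2_mul (cls u) (cls v) = cls (WMul u v).
Proof. by apply/clsP/weq_mul; apply: rep_cls. Qed.
Lemma suq2_scaleE l u : suq2_scale l (cls u) = cls (WScal l u).
Proof. by apply/clsP/weq_mul; [apply: weq_refl|apply: rep_cls]. Qed.
Lemma suq2_oppE u : suq2_opp (cls u) = cls (WScal (-1) u).
Proof. exact: suq2_scaleE. Qed.
Definition suq2_opsE := (suq2_addE, suq2_mulE, suq2_scaleE, suq2_oppE).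

Lemma suq2_addA : associative suq2_add.
Proof.
by move=> x y z; rewrite -(repK x) -(repK y) -(repK z) !suq2_opsE;
  apply/clsP/weq_addA.
Qed.
Lemma suq2_addC : commutative suq2_add.
Proof.
by move=> x y; rewrite -(repK x) -(repK y) !suq2_opsE; apply/clsP/weq_addC.
Qed.
Lemma suq2_add0 : left_id (cls (WCst 0)) suq2_add.
Proof. by move=> x; rewrite -(repK x) !suq2_opsE; apply/clsP/weq_add0. Qed.
Lemma suq2_addN : left_inverse (cls (WCst 0)) suq2_opp suq2_add.
Proof. by move=> x; rewrite -(repK x) !suq2_opsE; apply/clsP/weq_addN. Qed.
Lemma suq2_mulA : associative suq2_mul.
Proof.
by move=> x y z; rewrite -(repK x) -(repK y) -(repK z) !suq2_opsE;
  apply/clsP/weq_mulA.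
Qed.
Lemma suq2_mul1l : left_id (cls (WCst 1)) suq2_mul.
Proof. by move=> x; rewrite -(repK x) !suq2_opsE; apply/clsP/weq_mul1. Qed.
Lemma suq2_mul1r : right_id (cls (WCst 1)) suq2_mul.
Proof.
move=> x; rewrite -(repK x) !suq2_opsE; apply/clsP.
by apply: weq_trans (weq_mul1 _); apply/weq_sym/weq_cstC.
Qed.
Lemma suq2_mulDl : left_distributive suq2_mul suq2_add.
Proof.
by move=> x y z; rewrite -(repK x) -(repK y) -(repK z) !suq2_opsE;
  apply/clsP/weq_mulDl.
Qed.
Lemma suq2_mulDr : right_distributive suq2_mul suq2_add.
Proof.
by move=> x y z; rewrite -(repK x) -(repK y) -(repK z) !suq2_opsE;
  apply/clsP/weq_mulDr.
Qed.

Fixpoint weval (B : algType C) (f : gen -> B) (t : word) : B :=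
  match t with
  | WGen x => f x
  | WCst l => l%:A
  | WAdd u v => weval f u + weval f v
  | WMul u v => weval f u * weval f v
  end.

Definition gen_rel (B : algType C) (f : gen -> B) :=
  forall u v, word_rel u v -> weval f u = weval f v.

Lemma weval_weq (B : algType C) (f : gen -> B) : gen_rel f ->
  forall u v, weq u v -> weval f u = weval f v.
Proof.
move=> fr u v; elim=> {u v} //=.
- by move=> u v w _ -> _ ->.
- by move=> u u' v v' _ -> _ ->.
- by move=> u u' v v' _ -> _ ->.
- by move=> u v; rewrite addrC.
- by move=> u v w; rewrite addrA.
- by move=> u; rewrite scale0r add0r.
- by move=> u; rewrite scaleN1r mulN1r addNr scale0r.
- by move=> u v w; rewrite mulrA.
- by move=> u; rewrite scale1r mul1r.
- by move=> u v w; rewrite mulrDl.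
- by move=> u v w; rewrite mulrDr.
- by move=> k l; rewrite scalerDl.
- by move=> k l; rewrite -scalerAl mul1r scalerA.
- by move=> k u; rewrite -scalerAl mul1r -scalerAr mulr1.
Qed.

Lemma suq2_one_neq0 : cls (WCst 1) != cls (WCst 0).
Proof.
apply/negP => /eqP/clsP.
pose f x : C^o := match x with Ga | Gas => 1 | _ => 0 end.
suff fr : gen_rel f.
  move=> /(weval_weq fr) /=; rewrite scale1r scale0r => /eqP.
  by rewrite oner_eq0.
by move=> u v [] /=; rewrite ?(mulr0, mul0r, mulr1, addr0, scale1r, scaler0).
Qed.

HB.instance Definition _ := GRing.isNzRing.Build suq2
  suq2_addA suq2_addC suq2_add0 suq2_addN suq2_mulA suq2_mul1l suq2_mul1r
  suq2_mulDl suq2_mulDr suq2_one_neq0.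

Lemma clsD u v : cls (WAdd u v) = cls u + cls v.
Proof. by rewrite -suq2_addE. Qed.
Lemma clsM u v : cls (WMul u v) = cls u * cls v.
Proof. by rewrite -suq2_mulE. Qed.

Lemma suq2_scaleM l x : suq2_scale l x = cls (WCst l) * x.
Proof. by rewrite -(repK x) suq2_scaleE clsM. Qed.
Lemma suq2_scaleA k l x : suq2_scale k (suq2_scale l x) = suq2_scale (k * l) x.
Proof.
rewrite !suq2_scaleM mulrA; congr (_ * x); rewrite -clsM.
by apply/clsP/weq_sym/weq_cstM.
Qed.
Lemma suq2_scale1 : left_id 1 suq2_scale.
Proof. by move=> x; rewrite suq2_scaleM mul1r. Qed.
Lemma suq2_scaleDr : right_distributive suq2_scale +%R.
Proof. by move=> l x y; rewrite !suq2_scaleM mulrDr. Qed.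
Lemma suq2_scaleDl x : {morph suq2_scale^~ x : k l / k + l}.
Proof.
move=> k l; rewrite !suq2_scaleM -mulrDl; congr (_ * x); rewrite -clsD.
by apply/clsP/weq_cstD.
Qed.

HB.instance Definition _ := GRing.Zmodule_isLmodule.Build C suq2
  suq2_scaleA suq2_scale1 suq2_scaleDr suq2_scaleDl.

Lemma suq2_scaleAl (l : C) (x y : suq2) : l *: (x * y) = (l *: x) * y.
Proof.
have E z : l *: z = cls (WCst l) * z := suq2_scaleM l z.
by rewrite !E mulrA.
Qed.
HB.instance Definition _ := GRing.Lmodule_isLalgebra.Build C suq2 suq2_scaleAl.

Lemma suq2_scaleAr (l : C) (x y : suq2) : l *: (x * y) = x * (l *: y).
Proof.
have E z : l *: z = cls (WCst l) * z := suq2_scaleM l z.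
rewrite !E !mulrA; congr (_ * y); rewrite -(repK x) -!clsM.
by apply/clsP/weq_cstC.
Qed.
HB.instance Definition _ := GRing.Lalgebra_isAlgebra.Build C suq2 suq2_scaleAr.

Lemma clsC l : cls (WCst l) = l%:A.
Proof.
have -> : l%:A = cls (WCst l) * 1 :> suq2 by rewrite -suq2_scaleM.
by rewrite mulr1.
Qed.

Lemma clsZ l u : cls (WScal l u) = l *: cls u.
Proof. by rewrite clsM clsC -scalerAl mul1r. Qed.

Lemma weval_cls t : weval (cls \o WGen) t = cls t.
Proof.
by elim: t => //= [l|u -> v ->|u -> v ->]; rewrite ?clsC ?clsD ?clsM.
Qed.

Definition suq2_ext (B : algType C) (f : gen -> B) (x : suq2) : B :=
  weval f (rep x).

Lemma suq2_extE (B : algType C) (f : gen -> B) : gen_rel f ->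
  forall t, suq2_ext f (cls t) = weval f t.
Proof. by move=> fr t; apply: weval_weq fr _ _ (rep_cls t). Qed.

Lemma suq2_ext_lrmorphism (B : algType C) (f : gen -> B) (fr : gen_rel f) :
  linear (suq2_ext f) /\ monoid_morphism (suq2_ext f).
Proof.
have E := suq2_extE fr.
split; [|split].
- move=> l x y; rewrite -(repK x) -(repK y) -clsZ -clsD !E /=.
  by rewrite -scalerAl mul1r.
- by rewrite -[1]/(cls (WCst 1)) E /= scale1r.
- by move=> x y; rewrite -(repK x) -(repK y) -clsM !E.
Qed.

Lemma weq_star u v : weq u v -> weq (wstar u) (wstar v).
Proof.
have sc l t : weq (WMul t (WCst l)) (WScal l t) by apply/weq_sym/weq_cstC.
have conjQ : Num.conj Q = Q by apply: CrealP; apply/complex_realP; exists q.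
elim=> {u v}.
- move=> u v; case=> /=; rewrite ?rmorph1 ?rmorphXn ?conjQ /= ?conjQ.
  + exact: weq_trans (weq_rel Rac') (weq_cstC _ _).
  + exact: weq_trans (weq_rel Rac) (weq_cstC _ _).
  + exact: weq_trans (weq_rel Racs') (weq_cstC _ _).
  + exact: weq_trans (weq_rel Racs) (weq_cstC _ _).
  + exact/weq_rel/Rccs.
  + exact/weq_rel/Raa.
  + apply: weq_trans (weq_add (weq_refl _) (sc _ _)) _; apply/weq_rel/Raas.
- by move=> u; apply: weq_refl.
- by move=> u v _; apply: weq_sym.
- by move=> u v w _ uv _; apply: weq_trans.
- by move=> u u' v v' _ ? _ ?; apply: weq_add.
- by move=> u u' v v' _ ? _ ?; apply: weq_mul.
- by move=> u v; apply: weq_addC.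
- by move=> u v w; apply: weq_addA.
- by move=> u /=; rewrite rmorph0; apply: weq_add0.
- move=> u /=; rewrite rmorph0 rmorphN1.
  apply: weq_trans _ (weq_addN (wstar u)).
  exact: weq_add (sc _ _) (weq_refl _).
- by move=> u v w /=; apply/weq_sym/weq_mulA.
- move=> u /=; rewrite rmorph1; apply: weq_trans (sc _ _) _; exact: weq_mul1.
- by move=> u v w; apply: weq_mulDr.
- by move=> u v w; apply: weq_mulDl.
- by move=> k l /=; rewrite rmorphD; apply: weq_cstD.
- by move=> k l /=; rewrite mulrC rmorphM; apply: weq_cstM.
- by move=> k u /=; apply: weq_sym; apply: weq_cstC.
Qed.

Definition suq2_star (x : suq2) : suq2 := cls (wstar (rep x)).

Lemma suq2_starE t : suq2_star (cls t) = cls (wstar t).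
Proof. by apply/clsP/weq_star/rep_cls. Qed.

Lemma wstarK : involutive wstar.
Proof.
by elim=> [[]|l|u uK v vK|u uK v vK] //=; rewrite ?uK ?vK // conjCK.
Qed.

Lemma suq2_starK : involutive suq2_star.
Proof. by move=> x; rewrite -(repK x) !suq2_starE wstarK. Qed.
Lemma suq2_starD : {morph suq2_star : x y / x + y}.
Proof.
by move=> x y; rewrite -(repK x) -(repK y) -clsD !suq2_starE /= clsD.
Qed.
Lemma suq2_starM x y : suq2_star (x * y) = suq2_star y * suq2_star x.
Proof. by rewrite -(repK x) -(repK y) -clsM !suq2_starE /= clsM. Qed.
Lemma suq2_starZ (l : C) x : suq2_star (l *: x) = Num.conj l *: suq2_star x.
Proof.
by rewrite -(repK x) -clsZ !suq2_starE /= clsM clsC -scalerAr mulr1.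
Qed.

HB.instance Definition _ := Algebra_isStar.Build C suq2
  suq2_starK suq2_starD suq2_starZ suq2_starM.

Definition qa : suq2 := cls (WGen Ga).
Definition qc : suq2 := cls (WGen Gc).

Lemma star_cls t : star (cls t) = cls (wstar t).
Proof. exact: suq2_starE. Qed.

Lemma suq2_relP : suq2_rel qa qc.
Proof.
split; rewrite ?star_cls -?clsM -?clsZ -?clsD -?[1]/(cls (WCst 1));
  apply/clsP/weq_rel; by [apply: Rac|apply: Racs|apply: Rccs|apply: Raa|
  apply: Raas].
Qed.

Definition gen_img (B : starAlgType C) (a c : B) (x : gen) : B :=
  match x with Ga => a | Gas => star a | Gc => c | Gcs => star c end.

Lemma gen_img_rel (B : starAlgType C) (a c : B) :
  suq2_rel a c -> gen_rel (gen_img a c).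
Proof.
have conjQ : Num.conj Q = Q by apply: CrealP; apply/complex_realP; exists q.
case=> r1 r2 r3 r4 r5 u v [] /=; rewrite -?scalerAl ?mul1r ?scale1r //.
- by rewrite -starM r1 starZ conjQ starM.
- by rewrite -[c]starK -starM starK r2 starZ conjQ starM starK.
Qed.

(* omega_- x = sigma(x) omega_- *)
Definition sigma_gen (x : gen) : suq2 :=
  match x with
  | Ga => Q^-1 *: qa | Gas => Q *: star qa
  | Gc => Q^-1 *: qc | Gcs => Q *: star qc
  end.

Definition sigma : suq2 -> suq2 := suq2_ext sigma_gen.

(* D(x) = delta(x) omega_-, so that D(x y) = D(x) y + x D(y) reads
   delta(x y) = delta(x) sigma(y) + x delta(y). *)
Fixpoint wdelta (t : word) : suq2 :=
  match t with
  | WGen Ga | WGen Gc | WCst _ => 0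
  | WGen Gas => (Num.sqrt q)%:C *: qc
  | WGen Gcs => - ((Num.sqrt q)^-1)%:C *: qa
  | WAdd u v => wdelta u + wdelta v
  | WMul u v => wdelta u * sigma (cls v) + cls u * wdelta v
  end.

Definition delta (x : suq2) : suq2 := wdelta (rep x).

Lemma suq2_relations :
  [/\ qa * qc = Q *: (qc * qa),
      star qc * star qa = Q *: (star qa * star qc),
      qa * star qc = Q *: (star qc * qa)
    & qc * star qa = Q *: (star qa * qc)] /\
  [/\ qc * star qc = star qc * qc, star qa * qa + star qc * qc = 1
    & qa * star qa + Q ^+ 2 *: (qc * star qc) = 1].
Proof.
have r u v (h : word_rel u v) := gen_img_rel suq2_relP h.
split; [split; [have := r _ _ Rac|have := r _ _ Rac'|have := r _ _ Racs
  |have := r _ _ Racs']|split; [have := r _ _ Rccs|have := r _ _ Raa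
  |have := r _ _ Raas]]; by rewrite /= -?scalerAl ?mul1r ?scale1r.
Qed.

Lemma sigma_rel : 0 < q -> gen_rel sigma_gen.
Proof.
move=> q0; have Q0 : Q != 0 by rewrite fmorph_eq0 gt_eqF.
have [[r1 r2 r3 r4] [r5 r6 r7]] := suq2_relations.
move=> u v [] /=; rewrite ?scale1r -?[Q%:A * _]scalerAl
  -?[(Q ^+ 2)%:A * _]scalerAl ?mul1r -!scalerAl -!scalerAr !scalerA.
- by rewrite r1 scalerA; congr (_ *: _); field.
- by rewrite r2 scalerA; congr (_ *: _); field.
- by rewrite r3 !scalerA; congr (_ *: _); field.
- by rewrite r4 !scalerA; congr (_ *: _); field.
- by rewrite r5; congr (_ *: _); field.
- by rewrite mulfV // !scale1r.
- rewrite -[RHS]r7 -[X in _ = X + _]scale1r.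
  by congr (_ *: _ + _ *: _); field.
Qed.

Lemma sigmaE : 0 < q -> forall t, sigma (cls t) = weval sigma_gen t.
Proof. by move=> q0; apply/suq2_extE/sigma_rel. Qed.

Lemma sigma_lrmorphism : 0 < q -> linear sigma /\ monoid_morphism sigma.
Proof. by move=> q0; apply/suq2_ext_lrmorphism/sigma_rel. Qed.

Lemma wdelta_weq : 0 < q -> forall u v, weq u v -> wdelta u = wdelta v.
Proof.
move=> q0; have Q0 : Q != 0 by rewrite fmorph_eq0 gt_eqF.
have [sl [s1 sM]] := sigma_lrmorphism q0.
have sD x y : sigma (x + y) = sigma x + sigma y.
  by have := sl 1 x y; rewrite !scale1r.
have s0 : sigma 0 = 0.
  by apply: (addrI (sigma 0)); rewrite -sD !addr0.
have sZ l x : sigma (l *: x) = l *: sigma x.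
  by have := sl l x 0; rewrite s0 !addr0.
have sC l : sigma (cls (WCst l)) = l%:A by rewrite clsC sZ s1.
set p := (Num.sqrt q)%:C.
have p0 : p != 0 by rewrite fmorph_eq0 sqrtr_eq0 -ltNge.
have pV : ((Num.sqrt q)^-1)%:C = p^-1 by rewrite fmorphV.
have pp : Q = p * p by rewrite -rmorphM -expr2 sqr_sqrtr // ltW.
move=> u v; elim=> {u v}.
- move=> u v uv.
  have [[r1 r2 r3 r4] [r5 r6 r7]] := suq2_relations.
  have gE : (sigma (cls wa) = Q^-1 *: qa) * (sigma (cls was) = Q *: star qa) *
            (sigma (cls wc) = Q^-1 *: qc) * (sigma (cls wcs) = Q *: star qc).
    by rewrite !sigmaE.
  have wE : (cls was = star qa) * (cls wcs = star qc) * (cls wa = qa) *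
     (cls wc = qc).
    by rewrite !star_cls.
  have xa : qa * star qa = 1 - Q ^+ 2 *: (qc * star qc) by rewrite -r7 addrK.
  have xas : star qa * qa = 1 - qc * star qc by rewrite -r6 r5 addrK.
  case: uv => /=; rewrite -/p ?gE ?wE ?clsC ?(mul0r, mulr0, addr0, add0r) //;
    rewrite -?scalerAl ?mul1r ?scaler0 // ?pV -?scalerAr.
  + rewrite !scalerDr !scalerA xa xas -r5 !scalerBr !scalerA.
    rewrite -!scaleNr -addrA -scalerDl [RHS]addrCA -scalerDl !pp.
    by congr (_ *: _ + _ *: _); field.
  + by rewrite !scalerA !pp; congr (_ *: _); field.
  + by rewrite !scalerA !pp; congr (_ *: _); field.
  + by rewrite r1 !scalerA !pp; congr (_ *: _); field.
  + rewrite r1 !scalerA -scalerDl !pp.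
    by rewrite (_ : _ + _ = 0) ?scale0r //; field.
  + rewrite r1 !scalerA -scalerDl !pp.
    by rewrite (_ : _ + _ = 0) ?scale0r //; field.
- by [].
- by [].
- by move=> u v w _ -> _ ->.
- by move=> u u' v v' _ /= -> _ ->.
- by move=> u u' v v' /clsP uE /= -> /clsP vE ->; rewrite uE vE.
- by move=> u v /=; rewrite addrC.
- by move=> u v w /=; rewrite addrA.
- by move=> u /=; rewrite add0r.
- move=> u /=; rewrite mul0r add0r clsC -scalerAl mul1r.
  by rewrite scaleN1r addNr.
- move=> u v w /=; rewrite !clsM !sM mulrDl mulrDr !mulrA addrA.
  by rewrite -!mulrA.
- by move=> u /=; rewrite mul0r add0r clsC scale1r mul1r.
- by move=> u v w /=; rewrite !clsD !mulrDl addrACA.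
- by move=> u v w /=; rewrite !clsD sD !mulrDr addrACA.
- by move=> k l /=; rewrite addr0.
- by move=> k l /=; rewrite mul0r mulr0 addr0.
- move=> k u /=; rewrite mul0r mulr0 add0r addr0 sC clsC.
  by rewrite -scalerAl -scalerAr mul1r mulr1.
Qed.

Lemma delta_cls t : 0 < q -> delta (cls t) = wdelta t.
Proof. by move=> q0; apply/wdelta_weq/rep_cls. Qed.

Lemma deltaM x y : 0 < q -> delta (x * y) = delta x * sigma y + x * delta y.
Proof.
by move=> q0; rewrite -(repK x) -(repK y) -clsM !delta_cls.
Qed.

Lemma deltaP l x y : 0 < q -> delta (l *: x + y) = l *: delta x + delta y.
Proof.
move=> q0; rewrite -(repK x) -(repK y) -clsZ -clsD !delta_cls //=.
by rewrite mul0r add0r clsC -scalerAl mul1r.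
Qed.

Lemma delta_gen : 0 < q ->
  [/\ delta qa = 0, delta qc = 0,
      delta (star qa) = (Num.sqrt q)%:C *: qc
    & delta (star qc) = - ((Num.sqrt q)^-1)%:C *: qa].
Proof. by move=> q0; rewrite !star_cls !delta_cls. Qed.

Definition CP_gens (B : starAlgType C) (a c : B) : set B :=
  [set a * star c; c * star a; c * star c].

Definition CP : set suq2 := smallest (@star_subalg _ suq2) (CP_gens qa qc).

Lemma CP_star_subalg : star_subalg CP.
Proof.
split.
- by move=> S [[? _ _ _ _] _].
- move=> x y Sx Sy S HS; have [[_ + _ _ _] _] := HS.
  by apply; [apply: Sx|apply: Sy].
- by move=> l x Sx S HS; have [[_ _ + _ _] _] := HS; apply; apply: Sx.
- move=> x y Sx Sy S HS; have [[_ _ _ + _] _] := HS.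
  by apply; [apply: Sx|apply: Sy].
- by move=> x Sx S HS; have [[_ _ _ _ +] _] := HS; apply; apply: Sx.
Qed.

Definition unital_subalg (S : set suq2) :=
  [/\ S 1,
      forall x y, S x -> S y -> S (x + y),
      forall (l : C) x, S x -> S (l *: x)
    & forall x y, S x -> S y -> S (x * y)].

Lemma CP_ind (P : set suq2) : unital_subalg P -> CP_gens qa qc `<=` P ->
  CP `<=` P.
Proof.
move=> [P1 PD PZ PM] Pg.
have sub : CP `<=` [set x | P x /\ P (star x)].
  apply: smallest_sub; first split.
  - have s1 : star (1 : suq2) = 1.
      by rewrite -[1]/(cls (WCst 1)) star_cls /= rmorph1.
    by rewrite /= s1.
  - by move=> x y [? ?] [? ?]; rewrite /= starD; split; apply: PD.
  - by move=> l x [? ?]; rewrite /= starZ; split; apply: PZ.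
  - by move=> x y [? ?] [? ?]; rewrite /= starM; split; apply: PM.
  - by move=> x [? ?]; rewrite /= starK.
  move=> x gx; split; first exact: Pg.
  apply: Pg; case: gx => [[]|] ->; rewrite starM starK.
  - by left; right.
  - by left; left.
  - by right.
by move=> x /sub [].
Qed.

Record CPel := MkCP { CPval : suq2; CPvalP : CP CPval }.

Definition subbimod (M : set suq2) :=
  [/\ M 0,
      forall x y, M x -> M y -> M (x + y),
      forall f x, CP f -> M x -> M (f * x)
    & forall f x, CP f -> M x -> M (x * f)].

Definition L_gens (n : int) : set suq2 :=
  [set x | exists2 m : nat, (m <= `|n|)%N &
     x = if 0 <= n then star qc ^+ m * star qa ^+ (`|n| - m)
         else qc ^+ m * qa ^+ (`|n| - m)].

Definition Lset (n : int) : set suq2 := smallest subbimod (L_gens n).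

Lemma Lset_subbimod n : subbimod (Lset n).
Proof.
split.
- by move=> S [[? _ _ _] _].
- move=> x y Sx Sy S HS; have [[_ + _ _] _] := HS.
  by apply; [apply: Sx|apply: Sy].
- by move=> f x Cf Sx S HS; have [[_ _ + _] _] := HS; apply=> //; apply: Sx.
- by move=> f x Cf Sx S HS; have [[_ _ _ +] _] := HS; apply=> //; apply: Sx.
Qed.

Lemma Lset_scale n (l : C) x : Lset n x -> Lset n (l *: x).
Proof.
have [_ _ LM _] := Lset_subbimod n; have [C1 _ CZ _ _] := CP_star_subalg.
by move=> Lx; rewrite -[x]mul1r scalerAl; apply: LM => //; apply: CZ.
Qed.

Definition inL (n : int) : {pred suq2} := fun x => `[< Lset n x >].

Lemma inL_submod n : subsemimod_closed (inL n).
Proof.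
have [L0 LD _ _] := Lset_subbimod n; split; first split.
- exact/asboolP.
- by move=> x y /asboolP Lx /asboolP Ly; apply/asboolP; apply: LD.
- by move=> l x /asboolP Lx; apply/asboolP; apply: Lset_scale.
Qed.

HB.instance Definition _ n :=
  GRing.isSubmodClosed.Build C suq2 (inL n) (inL_submod n).

Record Lmod (n : int) := MkL { Lval : suq2; LvalP : Lval \in inL n }.
HB.instance Definition _ n := [isSub for @Lval n].
HB.instance Definition _ n := [Choice of Lmod n by <:].
HB.instance Definition _ n := [SubChoice_isSubLmodule of Lmod n by <:].

Lemma lact_subproof n (f : CPel) (x : Lmod n) : CPval f * Lval x \in inL n.
Proof.
have [_ _ LM _] := Lset_subbimod n.
by apply/asboolP; apply: LM; [apply: CPvalP|apply/asboolP/LvalP].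
Qed.
Definition lact n f x : Lmod n := MkL (lact_subproof f x).

Lemma ract_subproof n (x : Lmod n) (f : CPel) : Lval x * CPval f \in inL n.
Proof.
have [_ _ _ LM] := Lset_subbimod n.
by apply/asboolP; apply: LM; [apply: CPvalP|apply/asboolP/LvalP].
Qed.
Definition ract n x f : Lmod n := MkL (ract_subproof x f).

(* Omega^{0,1} = L_{-2} omega_-; x omega_- is represented by x.  Since omega_-
   commutes with CP, the right action of CP is (x omega_-) f = x f omega_-. *)
Definition Omega := Lmod (-2).

Lemma sigma_CP f : 0 < q -> CP f -> sigma f = f.
Proof.
move=> q0; have Q0 : Q != 0 by rewrite fmorph_eq0 gt_eqF.
have [sl [s1 sM]] := sigma_lrmorphism q0.
have sD x y : sigma (x + y) = sigma x + sigma y.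
  by have := sl 1 x y; rewrite !scale1r.
have s0 : sigma 0 = 0.
  by apply: (addrI (sigma 0)); rewrite -sD !addr0.
have sZ l x : sigma (l *: x) = l *: sigma x.
  by have := sl l x 0; rewrite s0 !addr0.
have gE : (sigma qa = Q^-1 *: qa) * (sigma (star qa) = Q *: star qa) *
          (sigma qc = Q^-1 *: qc) * (sigma (star qc) = Q *: star qc).
  by rewrite !star_cls !sigmaE //= !star_cls.
move: f; apply: CP_ind; first split=> //=.
- by move=> x y xE yE; rewrite sD xE yE.
- by move=> l x xE; rewrite sZ xE.
- by move=> x y xE yE; rewrite sM xE yE.
move=> x [[]|] ->; rewrite /= sM !gE -scalerAl -scalerAr scalerA
  ?mulVf ?scale1r //.
Qed.

Lemma delta_CP f : 0 < q -> CP f -> Lset (-2) (delta f).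
Proof.
move=> q0 Cf; suff [] : CP f /\ Lset (-2) (delta f) by [].
move: f Cf; have [L0 LD Ll Lr] := Lset_subbimod (-2).
have [C1 CD CZ CM _] := CP_star_subalg.
have d1 : delta 1 = 0 by rewrite -[1]/(cls (WCst 1)) delta_cls.
have d0 : delta 0 = 0 by rewrite -[0]/(cls (WCst 0)) delta_cls.
have dD x y : delta (x + y) = delta x + delta y.
  by have := deltaP 1 x y q0; rewrite !scale1r.
have dZ l x : delta (l *: x) = l *: delta x.
  by have := deltaP l x 0 q0; rewrite d0 !addr0.
have Lg m : (m <= 2)%N -> Lset (-2) (qc ^+ m * qa ^+ (2 - m)).
  by move=> m2; apply: sub_gen_smallest; exists m.
apply: CP_ind; first split.
- by rewrite /= d1.
- by move=> x y [? ?] [? ?]; split; [apply: CD|rewrite dD; apply: LD].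
- by move=> l x [? ?]; split; [apply: CZ|rewrite dZ; apply: Lset_scale].
- move=> x y [? ?] [? ?]; split; first exact: CM.
  by rewrite deltaM // sigma_CP //; apply: LD; [apply: Lr|apply: Ll].
have [da dc das dcs] := delta_gen q0.
move=> x gx; split; first exact: sub_gen_smallest.
case: gx => [[]|] ->; rewrite deltaM // ?da ?dc ?das ?dcs mul0r add0r -scalerAr;
  apply: Lset_scale.
- by have := Lg 0%N isT; rewrite expr0 mul1r.
- by have := Lg 2%N isT; rewrite expr0 mulr1.
- by have := Lg 1%N isT; rewrite !expr1.
Qed.

Definition dbar (f : CPel) : Omega := insubd 0 (delta (CPval f)).

Lemma dbarE f : 0 < q -> Lval (dbar f) = delta (CPval f).
Proof.
move=> q0; rewrite -[Lval _]/(val _) insubdK //.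
by apply/asboolP; apply: delta_CP => //; apply: CPvalP.
Qed.

Section Tensor.
Variables m n : int.

(* L_m (x)_CP L_n, as formal sums of elementary tensors. *)
Definition ftens := seq (Lmod m * Lmod n).

Inductive teq : ftens -> ftens -> Prop :=
  | teq_refl s : teq s s
  | teq_sym s t : teq s t -> teq t s
  | teq_trans s t u : teq s t -> teq t u -> teq s u
  | teq_cat s s' t t' : teq s s' -> teq t t' -> teq (s ++ t) (s' ++ t')
  | teq_catC s t : teq (s ++ t) (t ++ s)
  | teq_0 y : teq [:: (0, y)] [::]
  | teq_addl x x' y : teq [:: (x + x', y)] [:: (x, y); (x', y)]
  | teq_addr x y y' : teq [:: (x, y + y')] [:: (x, y); (x, y')]
  | teq_mid x f y : teq [:: (ract x f, y)] [:: (x, lact f y)].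

Definition teqb : rel ftens := fun s t => `[< teq s t >].

Lemma teqb_refl : reflexive teqb.
Proof. by move=> u; apply/asboolP/teq_refl. Qed.
Lemma teqb_sym : symmetric teqb.
Proof. by move=> u v; apply/asboolP/asboolP => /teq_sym. Qed.
Lemma teqb_trans : transitive teqb.
Proof.
by move=> v u w /asboolP uv /asboolP vw; apply/asboolP/(teq_trans uv vw).
Qed.

Canonical teqb_equiv := EquivRel teqb teqb_refl teqb_sym teqb_trans.

Definition tens : Type := {eq_quot teqb}.
HB.instance Definition _ := Choice.on tens.

Definition tcls (s : ftens) : tens := \pi_{eq_quot teqb} s.
Definition trep (x : tens) : ftens := repr (x : {eq_quot teqb}).

Lemma trepK x : tcls (trep x) = x.
Proof. exact: reprK. Qed.

Lemma tclsP s t : teq s t <-> tcls s = tcls t.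
Proof.
by split=> [st|/eqmodP/asboolP //]; apply/eqmodP/asboolP.
Qed.

Lemma trep_cls s : teq (trep (tcls s)) s.
Proof. by apply/tclsP; rewrite trepK. Qed.

Definition pure (x : Lmod m) (y : Lmod n) : tens := tcls [:: (x, y)].

Definition fmap (phi : Lmod m -> Lmod m) (s : ftens) : ftens :=
  [seq (phi p.1, p.2) | p <- s].

Definition tmap (phi : Lmod m -> Lmod m) (x : tens) : tens :=
  tcls (fmap phi (trep x)).

Definition rlin (phi : Lmod m -> Lmod m) :=
  {morph phi : x y / x + y} /\ forall x f, phi (ract x f) = ract (phi x) f.

Lemma fmap_teq phi s t : rlin phi -> teq s t -> teq (fmap phi s) (fmap phi t).
Proof.
move=> [phiD phiM]; have phi0 : phi 0 = 0.
  by apply: (addrI (phi 0)); rewrite -phiD !addr0.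
elim=> {s t}.
- by move=> s; apply: teq_refl.
- by move=> s t _; apply: teq_sym.
- by move=> s t u _ st _; apply: teq_trans.
- by move=> s s' t t' _ ? _ ?; rewrite /fmap !map_cat; apply: teq_cat.
- by move=> s t; rewrite /fmap !map_cat; apply: teq_catC.
- by move=> y; rewrite /= phi0; apply: teq_0.
- by move=> x x' y; rewrite /= phiD; apply: teq_addl.
- by move=> x y y'; apply: teq_addr.
- by move=> x f y; rewrite /= phiM; apply: teq_mid.
Qed.

Lemma tmapE phi s : rlin phi -> tmap phi (tcls s) = tcls (fmap phi s).
Proof. by move=> ?; apply/tclsP/fmap_teq => //; apply: trep_cls. Qed.

Lemma rlin_opp : rlin -%R.
Proof.
split=> [x y|x f]; first exact: opprD.
by apply: val_inj; rewrite /= mulNr.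
Qed.

Lemma rlin_scale (l : C) : rlin ( *:%R l).
Proof.
split=> [x y|x f]; first exact: scalerDr.
by apply: val_inj; rewrite /= scalerAl.
Qed.

Lemma rlin_lact f : rlin (lact f).
Proof.
by split=> [x y|x g]; apply: val_inj; rewrite /= ?mulrDr ?mulrA.
Qed.

Definition tadd x y := tcls (trep x ++ trep y).

Lemma taddE s t : tadd (tcls s) (tcls t) = tcls (s ++ t).
Proof. by apply/tclsP/teq_cat; apply: trep_cls. Qed.

Lemma taddA : associative tadd.
Proof.
by move=> x y z; rewrite -(trepK x) -(trepK y) -(trepK z) !taddE catA.
Qed.
Lemma taddC : commutative tadd.
Proof.
by move=> x y; rewrite -(trepK x) -(trepK y) !taddE; apply/tclsP/teq_catC.
Qed.
Lemma tadd0 : left_id (tcls [::]) tadd.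
Proof. by move=> x; rewrite -(trepK x) taddE. Qed.

Lemma fmap_add phi psi s :
  teq (fmap phi s ++ fmap psi s) (fmap (fun x => phi x + psi x) s).
Proof.
elim: s => [|[x y] s IH] /=; first exact: teq_refl.
apply: teq_trans (_ : teq _ (([:: (phi x, y)] ++ [:: (psi x, y)]) ++
   (fmap phi s ++ fmap psi s))) _.
  rewrite -[_ :: _]cat1s -!catA; apply: teq_cat; first exact: teq_refl.
  rewrite !catA -[_ :: fmap psi s]cat1s catA; apply: teq_cat (teq_refl _).
  exact: teq_catC.
rewrite -[X in teq _ X]cat1s; apply: teq_cat IH.
exact/teq_sym/teq_addl.
Qed.

Lemma fmap0 s : teq (fmap (fun=> 0) s) [::].
Proof.
elim: s => [|[x y] s IH] /=; first exact: teq_refl.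
by rewrite -cat1s -[X in teq _ X]cat0s; apply: teq_cat IH; apply: teq_0.
Qed.

Lemma taddN : left_inverse (tcls [::]) (tmap -%R) tadd.
Proof.
move=> x; rewrite -(trepK x) tmapE; last exact: rlin_opp.
rewrite taddE; apply/tclsP.
have E : fmap id (trep x) = trep x by rewrite -[RHS]map_id; apply: eq_map; case.
rewrite -{2}E; apply: teq_trans (fmap_add _ _ _) _.
by under eq_fun do rewrite addNr; apply: fmap0.
Qed.

HB.instance Definition _ := GRing.isZmodule.Build tens taddA taddC tadd0 taddN.

Lemma tclsD s t : tcls (s ++ t) = tcls s + tcls t.
Proof. by rewrite -taddE. Qed.

Definition tscale (l : C) := tmap ( *:%R l).

Lemma tscaleE l s : tscale l (tcls s) = tcls (fmap ( *:%R l) s).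
Proof. exact/tmapE/rlin_scale. Qed.

Lemma tscaleA k l x : tscale k (tscale l x) = tscale (k * l) x.
Proof.
rewrite -(trepK x) !tscaleE /fmap -map_comp; congr tcls; apply: eq_map => p /=.
by rewrite scalerA.
Qed.
Lemma tscale1 : left_id 1 tscale.
Proof.
move=> x; rewrite -(trepK x) tscaleE; congr tcls.
by rewrite -[RHS]map_id; apply: eq_map => -[y z] /=; rewrite scale1r.
Qed.
Lemma tscaleDr : right_distributive tscale +%R.
Proof.
move=> l x y; rewrite -(trepK x) -(trepK y) -tclsD !tscaleE -tclsD.
by rewrite /fmap map_cat.
Qed.
Lemma tscaleDl x : {morph tscale^~ x : k l / k + l}.
Proof.
move=> k l; rewrite -(trepK x) !tscaleE -tclsD; apply/tclsP/teq_sym.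
apply: teq_trans (fmap_add _ _ _) _.
by under eq_fun do rewrite -scalerDl; apply: teq_refl.
Qed.

HB.instance Definition _ := GRing.Zmodule_isLmodule.Build C tens
  tscaleA tscale1 tscaleDr tscaleDl.

(* f (x (x) y) = (f x) (x) y *)
Definition tlact (f : CPel) : tens -> tens := tmap (lact f).

Lemma tlact_pure f x y : tlact f (pure x y) = pure (lact f x) y.
Proof. exact/tmapE/rlin_lact. Qed.

Definition tsum (V : zmodType) (b : Lmod m -> Lmod n -> V) (t : tens) : V :=
  \sum_(p <- trep t) b p.1 p.2.

Definition balanced (V : zmodType) (b : Lmod m -> Lmod n -> V) :=
  [/\ forall x x' y, b (x + x') y = b x y + b x' y,
      forall x y y', b x (y + y') = b x y + b x y'
    & forall x f y, b (ract x f) y = b x (lact f y)].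

Lemma tsumE (V : zmodType) (b : Lmod m -> Lmod n -> V) s : balanced b ->
  tsum b (tcls s) = \sum_(p <- s) b p.1 p.2.
Proof.
move=> [bl br bm]; have := trep_cls s; rewrite /tsum; move: (trep _) => t.
elim=> {s t} //.
- by move=> s t u _ -> _ ->.
- by move=> s s' t t' _ sE _ tE; rewrite !big_cat /= sE tE.
- by move=> s t; rewrite !big_cat /= addrC.
- move=> y; rewrite big_seq1 big_nil /=.
  by apply: (addrI (b 0 y)); rewrite -bl !addr0.
- by move=> x x' y; rewrite big_seq1 big_cons big_seq1 /= bl.
- by move=> x y y'; rewrite big_seq1 big_cons big_seq1 /= br.
- by move=> x f y; rewrite !big_seq1 /= bm.
Qed.

End Tensor.

(* The multiplication maps L_n (x) Omega -> A omega_- and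
   Omega (x) L_n -> A omega_-; omega_- is moved to the right by sigma. *)
Definition mul_right n : tens n (-2) -> suq2 :=
  tsum (fun x y => Lval x * Lval y).

Definition mul_left n : tens (-2) n -> suq2 :=
  tsum (fun x y => Lval x * sigma (Lval y)).

Lemma mul_right_pure n (x : Lmod n) (y : Omega) :
  mul_right (pure x y) = Lval x * Lval y.
Proof.
rewrite /mul_right tsumE ?big_seq1 //; split=> [x1 x2 z|z x1 x2|z f x1] /=.
- by rewrite mulrDl.
- by rewrite mulrDr.
- by rewrite mulrA.
Qed.

Lemma mul_left_pure n (x : Omega) (y : Lmod n) : 0 < q ->
  mul_left (pure x y) = Lval x * sigma (Lval y).
Proof.
move=> q0; have [sl [_ sM]] := sigma_lrmorphism q0.
rewrite /mul_left tsumE ?big_seq1 //; split=> [x1 x2 z|z x1 x2|z f x1] /=.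
- by rewrite mulrDl.
- by have := sl 1 (Lval x1) (Lval x2); rewrite !scale1r => ->; rewrite mulrDr.
- by rewrite sM (sigma_CP q0 (CPvalP f)) mulrA.
Qed.

(* mul_left is injective, with image L_{n-2}; outside of L_{n-2} the value is
   the junk 0. *)
Definition mul_left_inv n (x : suq2) : tens (-2) n :=
  xget 0 [set t | mul_left t = x].

Definition Phi n (t : tens n (-2)) : tens (-2) n :=
  mul_left_inv n (mul_right t).

Definition nabla_std n (s : Lmod n) : tens (-2) n :=
  mul_left_inv n (delta (Lval s)).

Definition nabla_ n (theta : Omega) (s : Lmod n) : tens (-2) n :=
  nabla_std s - Phi (pure s theta).

Definition leibniz n (nabla : Lmod n -> tens (-2) n) :=
  forall (f : CPel) (s : Lmod n),
    nabla (lact f s) = pure (dbar f) s + tlact f (nabla s).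

(* Flatness is no condition, there being no (0,2)-forms. *)
Record holomorphic_structure (n : int) := HolomorphicStructure {
  nabla :> {linear Lmod n -> tens (-2) n};
  nabla_leibniz : leibniz nabla }.

(* The coproduct, extended multiplicatively to words; an element of the tensor
   square is given as a list of elementary tensors. *)
Fixpoint coprod (t : word) : seq (word * word) :=
  match t with
  | WGen Ga => [:: (wa, wa); (WScal (- Q) wcs, wc)]
  | WGen Gas => [:: (was, was); (WScal (- Q) wc, wcs)]
  | WGen Gc => [:: (wc, wa); (was, wc)]
  | WGen Gcs => [:: (wcs, was); (wa, wcs)]
  | WCst l => [:: (WCst l, WCst 1)]
  | WAdd u v => coprod u ++ coprod v
  | WMul u v => [seq (x.1 *** y.1, x.2 *** y.2) | x <- coprod u, y <- coprod v]
  end.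

End SUq2.

Section Completions.
Variables (R : realType) (q : R) (A : cstarAlgType R) (a c : A).
Local Notation C := (R[i]).

Definition universal_suq2 :=
  suq2_rel q a c /\
  forall (B : cstarAlgType R) (x y : B), suq2_rel q x y ->
    exists! f : A -> B,
    [/\ linear f, monoid_morphism f, star_morph f, f a = x & f c = y].

Definition iota_suq2 : suq2 q -> A := suq2_ext (gen_img a c).

Lemma iota_suq2P : suq2_rel q a c ->
  [/\ linear iota_suq2, monoid_morphism iota_suq2, star_morph iota_suq2,
      iota_suq2 (qa q) = a & iota_suq2 (qc q) = c].
Proof.
move=> r; have fr := gen_img_rel r.
have [il im] := suq2_ext_lrmorphism fr.
have E := suq2_extE fr.
split=> //; [|exact: E|exact: E].
move=> x; rewrite -(repK x) star_cls /iota_suq2 !E; elim: (rep x) => /=.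
- by case=> /=; rewrite ?starK.
- move=> l; rewrite starZ; congr (_ *: _).
  by rewrite -[LHS]starK -[star 1]mulr1 -{2}[1](starK 1) -starM mulr1 !starK.
- by move=> u -> v ->; rewrite starD.
- by move=> u -> v ->; rewrite starM.
Qed.

(* The bound is automatic for positive h. *)
Definition state (h : A -> C) :=
  [/\ scalar h, forall x, 0 <= h (star x * x), h 1 = 1
    & forall x, Normc.normc (h x) <= cnorm x].

(* (id (x) h) Delta(x) = h(x) 1 for x in the dense subalgebra, written for
   an arbitrary representative t of x. *)
Definition left_invariant (h : A -> C) :=
  forall t : word R,
    \sum_(p <- coprod q t) h (iota_suq2 (cls q p.2)) *: cls q p.1 =
    h (iota_suq2 (cls q t)) *: 1.

Definition haar_state (h : A -> C) := state h /\ left_invariant h.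

Definition inner_product (H : completeNormedModType C) (ip : H -> H -> C) :=
  [/\ forall x, scalar (ip x), forall x y, ip y x = Num.conj (ip x y)
    & forall x, ip x x = `|x| ^+ 2].

Definition gns (h : A -> C) (H : completeNormedModType C) (ip : H -> H -> C)
    (Lam : A -> H) :=
  [/\ inner_product ip, linear Lam,
      forall x y, ip (Lam x) (Lam y) = h (star x * y)
    & dense (range Lam)].

Definition CCP : set A :=
  smallest (fun S => star_subalg S /\ cnorm_closed S) (CP_gens a c).

Section Gauge.
Variables (H : completeNormedModType C) (Lam : A -> H).

(* The closure of dbar is the operator whose graph this is; the closure in
   H x H lies in L^2(CP^1_q) x L^2(Omega^{0,1}), as x omega_- is identified
   with x. *)
Definition dbar_graph : set (H * H)%type :=
  closure [set z | exists f : CPel q,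
    z = (Lam (iota_suq2 (CPval f)), Lam (iota_suq2 (Lval (dbar f))))].

Definition in_Dom_dbar (g : A) := exists eta, dbar_graph (Lam g, eta).

(* With theta = x omega_-, the form theta g is x g omega_-, because omega_-
   commutes with CP. *)
Definition gauge_equivalent n (N1 N2 : holomorphic_structure q n) :=
  exists theta1 theta2 : Omega q,
    [/\ N1 =1 nabla_ theta1, N2 =1 nabla_ theta2 &
    exists g g' : A,
      [/\ CCP g, CCP g', g * g' = 1 & g' * g = 1] /\
      [/\ in_Dom_dbar g, in_Dom_dbar g' &
          dbar_graph (Lam g, Lam (g * iota_suq2 (Lval theta2) -
                                  iota_suq2 (Lval theta1) * g))]].

End Gauge.
End Completions.

(* Main.v *)
From HB Require Import structures.
Require Import Defs.
From mathcomp Require Import all_boot all_order all_algebra complex.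
From mathcomp Require Import all_classical all_reals.
From mathcomp Require Import topology normedtype sequences ring zify.
Import Order.TTheory GRing.Theory Num.Theory numFieldNormedType.Exports.
Set Implicit Arguments.
Unset Strict Implicit.
Unset Printing Implicit Defensive.
Local Open Scope ring_scope.
Local Open Scope classical_set_scope.
Local Open Scope complex_scope.

(** Let A(SU_q(2)) act on sequences by c e_k = q^k e_k and a e_k = w_k e_{k-1},
    where w_k is the square root of 1 - q^(2k). Here c is invertible, and dbar is
    a commutator: delta f = f x - x f for f in A(CP^1_q), with
    x = kappa (star c)^-1 a ([delta_commutator]). So the gauge equation
    dbar g = g theta2 - theta1 g says that g intertwines two operators:
    g (x - theta2) = (x - theta1) g.

    For theta_k = kappa q^(-2k) c a, the operator x - theta_k is a weighted
    backward shift whose weights vanish at exactly one place, k. It is the sum of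
    a nilpotent Jordan block of size k + 1 and of a shift with nonzero weights,
    and k can be recovered from its similarity class. Concretely, the
    intertwining relation propagates zeros along the diagonals of the matrix of
    g, until it contradicts the existence of an inverse ([null_row],
    [null_columns], [no_intertwiner]).

    As g lies only in the completion and dbar g is defined through a closed
    graph, matrix entries must be controlled by the L2 norm. On A(CP^1_q) the
    Haar state is the trace h f = (1 - q^2) sum_k q^(2k) f_kk ([trace_approx]),
    whence (1 - q^2) q^(2j) |f_ij|^2 <= h (star f f) ([haar_entry_bound]). The
    trace formula follows from left invariance, tested against a triangular
    2 x 2 representation, which gives a recursion for the moments h (B_0^n)
    ([haar_moment]). The argument then runs on the entries of polynomials
    converging to g, all identities holding up to null sequences.

    That every theta defines a holomorphic structure on L_n, and is seen by it,
    rests on the multiplicativity of the bundles ([LsetM]) and on partitions of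
    unity ([partition_of_unity]): they make the multiplication map from
    Omega (x) L_n injective, with image L_{n-2} ([mul_left_eq0],
    [mul_left_surj]). *)

(** * The line bundles as a grading of A(SU_q(2)) *)

Section Grading.
Variables (R : realType) (q : R).
Hypothesis q0 : 0 < q.
Local Notation C := R[i].
Local Notation Q := (q%:C).
Local Notation SU := (suq2 q).
Local Notation CP := (@CP R q).
Local Notation Lset := (@Lset R q).
Local Notation L_gens := (@L_gens R q).
Local Notation a := (qa q : SU).
Local Notation c := (qc q : SU).
Local Notation a' := (star a : SU).
Local Notation c' := (star c : SU).

Lemma qC_neq0 : Q != 0.
Proof. by rewrite fmorph_eq0 gt_eqF. Qed.

Lemma normal_order :
  [/\ a * c = Q *: (c * a), a * c' = Q *: (c' * a),
      a' * c = Q^-1 *: (c * a') & a' * c' = Q^-1 *: (c' * a')] /\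
  [/\ c' * c = c * c', a' * a = 1 - c * c' & a * a' = 1 - Q ^+ 2 *: (c * c')].
Proof.
have [[r1 r2 r3 r4] [r5 r6 r7]] := suq2_relations q.
split; split=> //.
- by rewrite r4 scalerA mulVf ?qC_neq0 // scale1r.
- by rewrite r2 scalerA mulVf ?qC_neq0 // scale1r.
- by rewrite -r6 r5 addrK.
- by rewrite -r7 addrK.
Qed.

Lemma CPD f g : CP f -> CP g -> CP (f + g).
Proof. by have [_ + _ _ _] := CP_star_subalg q; apply. Qed.
Lemma CPM f g : CP f -> CP g -> CP (f * g).
Proof. by have [_ _ _ + _] := CP_star_subalg q; apply. Qed.
Lemma CPZ l f : CP f -> CP (l *: f).
Proof. by have [_ _ + _ _] := CP_star_subalg q; apply. Qed.
Lemma CP1 : CP 1.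
Proof. by have [] := CP_star_subalg q. Qed.
Lemma CP_star f : CP f -> CP (star f).
Proof. by have [_ _ _ _ +] := CP_star_subalg q; apply. Qed.
Lemma CPB f g : CP f -> CP g -> CP (f - g).
Proof. by move=> Cf Cg; apply: CPD => //; rewrite -scaleN1r; apply: CPZ. Qed.
Lemma CP0 : CP 0.
Proof. by rewrite -(subrr 1); apply: CPB; apply: CP1. Qed.

(** The generators of degree -1, on which delta vanishes; aholo picks their
    adjoints, of degree 1. *)
Definition holo (x : SU) := x = a \/ x = c.
Definition aholo (x : SU) := x = a' \/ x = c'.

Lemma CP_holo_aholo x y : holo x -> aholo y -> CP (x * y).
Proof.
have [_ [_ _ r7]] := normal_order.
have gen u v : CP_gens a c (u * v) -> CP (u * v).
  by move=> ?; apply: sub_gen_smallest.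
have Ccc : CP (c * c') by apply: gen; right.
move=> [->|->] [->|->] //.
- by rewrite r7; apply: CPB; [apply: CP1|apply: CPZ].
- by apply: gen; left; left.
- by apply: gen; left; right.
Qed.

Lemma CP_aholo_holo x y : holo x -> aholo y -> CP (y * x).
Proof.
have [[_ r2 r3 _] [r5 r6 _]] := normal_order.
have Ccc : CP (c * c') by apply: CP_holo_aholo; right.
move=> [->|->] [->|->].
- by rewrite r6; apply: CPB => //; apply: CP1.
- rewrite (_ : c' * a = Q^-1 *: (a * c')).
    by apply: CPZ; apply: CP_holo_aholo; [left|right].
  by rewrite r2 scalerA mulVf ?qC_neq0 // scale1r.
- by rewrite r3; apply: CPZ; apply: CP_holo_aholo; [right|left].
- by rewrite r5.
Qed.

Lemma one_aholo_holo : a' * a + c' * c = 1.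
Proof. by have [_ [? ? ?]] := suq2_relations q. Qed.

Lemma one_holo_aholo : a * a' + Q ^+ 2 *: (c * c') = 1.
Proof. by have [_ [? ? ?]] := suq2_relations q. Qed.

Lemma holo_split x f : x * f = (x * f * a') * a + (x * f * c') * c.
Proof. by rewrite -!mulrA -!mulrDr one_aholo_holo mulr1. Qed.

Lemma aholo_split y f :
  y * f = (y * f * a) * a' + Q ^+ 2 *: (y * f * c * c').
Proof. by rewrite -!mulrA !scalerAr -!mulrDr -scalerAr one_holo_aholo mulr1. Qed.

(** Each generator of CP is a product of a holo and an aholo element that commute
    up to a scalar, so that the sandwich regroups into two elements of degree 0.
    For a product f g, the unit written as a sum of products of generators is
    inserted between the factors. *)
Lemma CP_sandwich f : CP f ->
  forall x y, holo x -> aholo y -> CP (x * f * y) /\ CP (y * f * x).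
Proof.
have [[_ r2 r3 _] [r5 _ _]] := normal_order.
have ha : holo a by left.
have hc : holo c by right.
have ha' : aholo a' by left.
have hc' : aholo c' by right.
move: f; apply: CP_ind; first split=> /=.
- by move=> x y hx hy; rewrite !mulr1; split;
    [apply: CP_holo_aholo|apply: CP_aholo_holo].
- by move=> f g Hf Hg x y hx hy; rewrite !mulrDr !mulrDl;
    split; apply: CPD; by [apply: (Hf x y hx hy).1|apply: (Hg x y hx hy).1|
      apply: (Hf x y hx hy).2|apply: (Hg x y hx hy).2].
- by move=> l f Hf x y hx hy; rewrite -!scalerAr -!scalerAl;
    split; apply: CPZ; by [apply: (Hf x y hx hy).1|apply: (Hf x y hx hy).2].
- move=> f g Hf Hg x y hx hy; split.
    rewrite mulrA (holo_split x f) !mulrDl; apply: CPD.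
      rewrite (_ : _ * _ = (x * f * a') * (a * g * y)); last by rewrite !mulrA.
      by apply: CPM; [apply: (Hf x a' hx ha').1|apply: (Hg a y ha hy).1].
    rewrite (_ : _ * _ = (x * f * c') * (c * g * y)); last by rewrite !mulrA.
    by apply: CPM; [apply: (Hf x c' hx hc').1|apply: (Hg c y hc hy).1].
  rewrite mulrA (aholo_split y f) !mulrDl -!scalerAl; apply: CPD.
    rewrite (_ : _ * _ = (y * f * a) * (a' * g * x)); last by rewrite !mulrA.
    by apply: CPM; [apply: (Hf a y ha hy).2|apply: (Hg x a' hx ha').2].
  apply: CPZ.
  have -> : y * f * c * c' * g * x = (y * f * c) * (c' * g * x).
    by rewrite !mulrA.
  by apply: CPM; [apply: (Hf c y hc hy).2|apply: (Hg x c' hx hc').2].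
move=> f gf x y hx hy.
suff [u [v [s [hu hv fE fE']]]] : exists u v s,
    [/\ holo u, aholo v, f = u * v & f = s *: (v * u)].
  split; last by rewrite fE mulrA -[_ * v * x]mulrA; apply: CPM;
      apply: CP_aholo_holo.
  rewrite fE' -scalerAr -scalerAl mulrA -[_ * u * y]mulrA; apply: CPZ.
  by apply: CPM; apply: CP_holo_aholo.
case: gf => [[]|] ->.
- by exists a, c', Q.
- exists c, a', Q; split=> //.
  by rewrite r3 scalerA mulfV ?qC_neq0 // scale1r.
- by exists c, c', 1; rewrite r5 scale1r.
Qed.

Lemma L_gens_pos (N : nat) x : L_gens (N : int) x <->
  exists2 m : nat, (m <= N)%N & x = c' ^+ m * a' ^+ (N - m).
Proof. by []. Qed.

Lemma L_gens_neg (N : nat) x : L_gens (- (N : int)) x <->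
  exists2 m : nat, (m <= N)%N & x = c ^+ m * a ^+ (N - m).
Proof.
case: N => [|N].
  rewrite oppr0 L_gens_pos; split=> -[[|m]] // _ ->.
    by exists 0%N => //; rewrite !expr0.
  by exists 0%N => //; rewrite !expr0.
by [].
Qed.


Lemma Lset0 x : Lset 0 x -> CP x.
Proof.
move: x; apply: smallest_sub; first split.
- exact: CP0.
- exact: CPD.
- exact: CPM.
- by move=> f x Cf Cx; apply: CPM.
by move=> x /(L_gens_pos 0) [[|m]] // _ ->; rewrite !expr0 mulr1; apply: CP1.
Qed.

Lemma LsetD n x y : Lset n x -> Lset n y -> Lset n (x + y).
Proof. by have [_ + _ _] := Lset_subbimod q n; apply. Qed.
Lemma Lset_lmul n f x : CP f -> Lset n x -> Lset n (f * x).
Proof. by have [_ _ + _] := Lset_subbimod q n; apply. Qed.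
Lemma Lset_rmul n f x : CP f -> Lset n x -> Lset n (x * f).
Proof. by have [_ _ _ +] := Lset_subbimod q n; apply. Qed.
Lemma Lset_gen n x : L_gens n x -> Lset n x.
Proof. exact: sub_gen_smallest. Qed.

Lemma CP_Lset0 x : CP x -> Lset 0 x.
Proof.
move=> Cx; rewrite -[x]mulr1; apply: Lset_lmul => //.
by apply: Lset_gen; apply/(L_gens_pos 0); exists 0%N; rewrite // !expr0 mulr1.
Qed.

Lemma Lset01 : Lset 0 1.
Proof. by apply: CP_Lset0; apply: CP1. Qed.

Lemma comm_powl (x y : SU) (l : C) n : x * y = l *: (y * x) ->
  x * y ^+ n = l ^+ n *: (y ^+ n * x).
Proof.
move=> xy; elim: n => [|n IH]; first by rewrite !expr0 scale1r mulr1 mul1r.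
rewrite [y ^+ _]exprSr mulrA IH -scalerAl -[_ * x * y]mulrA xy -scalerAr.
by rewrite scalerA mulrA !exprSr.
Qed.

(** The identity holo_split commutes x past an element f of CP, at the price of
    replacing x by a and c; hence the statement for all holo x at once is
    stable under the left action of CP. *)
Lemma Lset_holo n x y : holo x -> Lset n y -> Lset (-1 + n) (x * y).
Proof.
suff sub : Lset n `<=`
    [set y | forall x, holo x -> Lset (-1 + n) (x * y)].
  by move=> hx Ly; apply: sub.
move=> {x y}; have [L0 _ _ _] := Lset_subbimod q (-1 + n).
have [ha hc] : holo a /\ holo c by split; [left|right].
have [ha' hc'] : aholo a' /\ aholo c' by split; [left|right].
have [[r1 _ _ _] _] := normal_order.
apply: smallest_sub; first split=> /=.
- by move=> x _; rewrite mulr0.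
- by move=> y z Hy Hz x hx; rewrite mulrDr; apply: LsetD; [apply: Hy|apply: Hz].
- move=> f y Cf Hy x hx; rewrite mulrA (holo_split x f) mulrDl.
  apply: LsetD; rewrite -mulrA; apply: Lset_lmul.
  + exact: (CP_sandwich Cf hx ha').1.
  + exact: Hy.
  + exact: (CP_sandwich Cf hx hc').1.
  + exact: Hy.
- by move=> f y Cf Hy x hx; rewrite mulrA; apply: Lset_rmul => //; apply: Hy.
move=> y gy x hx.
have [[N nE]|[N nE]] : (exists N : nat, n = N.+1) \/ (exists N : nat, n = - (N : int)).
- by case: n {L0 gy} => [[|N]|N]; [right; exists 0%N|left; exists N|right; exists N.+1].
- rewrite {}nE in gy L0 *.
  have -> : -1 + (N.+1 : int) = N by rewrite intS addKr.
  have {gy} [[|m] mN ->] := (L_gens_pos N.+1 y).1 gy.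
    rewrite expr0 mul1r subn0 exprS mulrA; apply: Lset_lmul.
      exact: CP_holo_aholo.
    by apply: Lset_gen; exists 0%N; rewrite // expr0 mul1r subn0.
  rewrite [_ ^+ m.+1]exprS -mulrA mulrA; apply: Lset_lmul; first exact: CP_holo_aholo.
  by apply: Lset_gen; exists m.
rewrite {}nE in gy L0 *.
have -> : -1 - (N : int) = - (N.+1 : int) by rewrite intS opprD.
have {gy} [m mN ->] := (L_gens_neg N y).1 gy.
case: hx => ->.
- rewrite mulrA (comm_powl _ r1) -scalerAl -mulrA -exprS; apply: Lset_scale.
  apply: Lset_gen; apply/L_gens_neg; exists m; first exact: leqW.
  by rewrite subSn.
- rewrite mulrA -exprS; apply: Lset_gen; apply/L_gens_neg; exists m.+1 => //.
Qed.

Lemma Lset_aholo n x y : aholo x -> Lset n y -> Lset (1 + n) (x * y).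
Proof.
suff sub : Lset n `<=`
    [set y | forall x, aholo x -> Lset (1 + n) (x * y)].
  by move=> hx Ly; apply: sub.
move=> {x y}; have [L0 _ _ _] := Lset_subbimod q (1 + n).
have [ha hc] : holo a /\ holo c by split; [left|right].
have [ha' hc'] : aholo a' /\ aholo c' by split; [left|right].
have [[_ _ _ r4] _] := normal_order.
apply: smallest_sub; first split=> /=.
- by move=> x _; rewrite mulr0.
- by move=> y z Hy Hz x hx; rewrite mulrDr; apply: LsetD; [apply: Hy|apply: Hz].
- move=> f y Cf Hy x hx; rewrite mulrA (aholo_split x f) mulrDl.
  apply: LsetD; last (rewrite -scalerAl; apply: Lset_scale);
    rewrite -[_ * _ * y]mulrA; apply: Lset_lmul.
  + exact: (CP_sandwich Cf ha hx).2.
  + exact: Hy.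
  + exact: (CP_sandwich Cf hc hx).2.
  + exact: Hy.
- by move=> f y Cf Hy x hx; rewrite mulrA; apply: Lset_rmul => //; apply: Hy.
move=> y gy x hx.
have [[N nE]|[N nE]] : (exists N : nat, n = N) \/ (exists N : nat, n = - (N.+1 : int)).
- by case: n {L0 gy} => [N|N]; [left; exists N|right; exists N].
- rewrite {}nE in gy L0 *; rewrite -intS.
  have {gy} [m mN ->] := (L_gens_pos N y).1 gy.
  case: hx => ->.
  + rewrite mulrA (comm_powl _ r4) -scalerAl -mulrA -exprS; apply: Lset_scale.
    apply: Lset_gen; exists m; first exact: leqW.
    by rewrite /= subSn.
  + by rewrite mulrA -exprS; apply: Lset_gen; exists m.+1.
rewrite {}nE in gy L0 *.
have -> : 1 - (N.+1 : int) = - (N : int) by rewrite intS opprD addNKr.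
have {gy} [[|m] mN ->] := (L_gens_neg N.+1 y).1 gy.
  rewrite expr0 mul1r subn0 exprS mulrA; apply: Lset_lmul.
    exact: CP_aholo_holo.
  apply: Lset_gen; apply/L_gens_neg.
  by exists 0%N; rewrite // expr0 mul1r subn0.
rewrite [_ ^+ m.+1]exprS -mulrA mulrA; apply: Lset_lmul; first exact: CP_aholo_holo.
by apply: Lset_gen; apply/L_gens_neg; exists m.
Qed.

(** The bundle L_n consists of sums of products of generators of total degree n;
    this is the resulting induction principle. *)
Lemma Lset_ind (P : int -> SU -> Prop) :
  (forall n, P n 0) ->
  (forall n x y, P n x -> P n y -> P n (x + y)) ->
  (forall n l x, P n x -> P n (l *: x)) ->
  (forall m n x y, P m x -> P n y -> P (m + n) (x * y)) ->
  P 0 1 -> P (-1) a -> P (-1) c -> P 1 a' -> P 1 c' ->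
  forall n x, Lset n x -> P n x.
Proof.
move=> P0 PD PZ PM P1 Pa Pc Pa' Pc'.
have PX n x k : P n x -> P (n *+ k) (x ^+ k).
  move=> Px; elim: k => [|k IH]; first by rewrite expr0 mulr0n.
  by rewrite exprS mulrS; apply: PM.
have PCP f : CP f -> P 0 f.
  move: f; apply: CP_ind.
    split=> //=; [exact: PD|exact: PZ|].
    by move=> x y Px Py; rewrite -[0]addr0; apply: PM.
  move=> x [[]|] ->; exact: (PM (-1) 1).
move=> n; apply: smallest_sub; first split=> //=; first exact: PD.
- by move=> f x /PCP Pf Px; rewrite -[n]add0r; apply: PM.
- by move=> f x /PCP Pf Px; rewrite -[n]addr0; apply: PM.
have [[N ->]|[N ->]] : (exists N : nat, n = N) \/ (exists N : nat, n = - (N : int)).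
- by case: n => [N|N]; [left; exists N|right; exists N.+1].
- move=> x /L_gens_pos [m mN ->].
  have -> : (N : int) = 1 *+ m + 1 *+ (N - m) by rewrite -mulrnDr subnKC // natz.
  by apply: PM; apply: PX.
- move=> x /L_gens_neg [m mN ->].
  have -> : - (N : int) = (-1) *+ m + (-1) *+ (N - m).
    by rewrite -mulrnDr subnKC // mulNrn natz.
  by apply: PM; apply: PX.
Qed.

Lemma LsetM m n x y : Lset m x -> Lset n y -> Lset (m + n) (x * y).
Proof.
move=> Lx; move: m x Lx n y.
apply: (Lset_ind (P := fun m x => forall n y, Lset n y -> Lset (m + n) (x * y))).
- by move=> m n y _; rewrite mul0r; have [] := Lset_subbimod q (m + n).
- by move=> m x y Hx Hy n z Lz; rewrite mulrDl; apply: LsetD; auto.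
- by move=> m l x Hx n y Ly; rewrite -scalerAl; apply: Lset_scale; auto.
- by move=> m n x y Hx Hy k z Lz; rewrite -addrA -mulrA; auto.
- by move=> n y Ly; rewrite add0r mul1r.
- by move=> n y; apply: Lset_holo; left.
- by move=> n y; apply: Lset_holo; right.
- by move=> n y; apply: Lset_aholo; left.
- by move=> n y; apply: Lset_aholo; right.
Qed.

Lemma Lset_holo1 x : holo x -> Lset (-1) x.
Proof.
by move=> hx; rewrite -[-1]addr0 -[x]mulr1; apply: Lset_holo => //;
  apply: CP_Lset0; apply: CP1.
Qed.

Lemma Lset_aholo1 x : aholo x -> Lset 1 x.
Proof.
by move=> hx; rewrite -[1]addr0 -[x]mulr1; apply: Lset_aholo => //;
  apply: CP_Lset0; apply: CP1.
Qed.

Lemma sigma_linear : linear (@sigma R q).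
Proof. exact: (sigma_lrmorphism q0).1. Qed.
Lemma sigmaM x y : sigma (x * y) = sigma x * sigma y :> SU.
Proof. by have [_ []] := sigma_lrmorphism q0. Qed.
Lemma sigma1 : sigma 1 = 1 :> SU.
Proof. by have [_ []] := sigma_lrmorphism q0. Qed.
Lemma sigmaD x y : sigma (x + y) = sigma x + sigma y :> SU.
Proof. by have := sigma_linear 1 x y; rewrite !scale1r. Qed.
Lemma sigma_0 : sigma 0 = 0 :> SU.
Proof. by apply: (addrI (sigma 0)); rewrite -sigmaD !addr0. Qed.
Lemma sigmaZ l x : sigma (l *: x) = l *: sigma x :> SU.
Proof. by have := sigma_linear l x 0; rewrite sigma_0 !addr0. Qed.

Lemma sigma_Lset n x : Lset n x -> sigma x = Q ^ n *: x.
Proof.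
have gE : [/\ sigma a = Q^-1 *: a, sigma a' = Q *: a',
          sigma c = Q^-1 *: c & sigma c' = Q *: c'].
  by rewrite !star_cls; split; rewrite sigmaE //= !star_cls.
case: gE => ga ga' gc gc'.
move: n x; apply: (Lset_ind (P := fun n x => sigma x = Q ^ n *: x)).
- by move=> n; rewrite sigma_0 scaler0.
- by move=> n x y xE yE; rewrite sigmaD xE yE scalerDr.
- by move=> n l x xE; rewrite sigmaZ xE !scalerA mulrC.
- move=> m n x y xE yE; rewrite sigmaM xE yE -scalerAl -scalerAr scalerA.
  by rewrite expfzDr ?qC_neq0.
- by rewrite sigma1 expr0z scale1r.
- by rewrite ga.
- by rewrite gc.
- by rewrite ga' expr1z.
- by rewrite gc' expr1z.
Qed.

Lemma deltaD x y : delta (x + y) = delta x + delta y :> SU.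
Proof. by have := deltaP 1 x y q0; rewrite !scale1r. Qed.
Lemma delta0 : delta 0 = 0 :> SU.
Proof. by apply: (addrI (delta 0)); rewrite -deltaD !addr0. Qed.
Lemma deltaZ l x : delta (l *: x) = l *: delta x :> SU.
Proof. by have := deltaP l x 0 q0; rewrite delta0 !addr0. Qed.
Lemma delta1 : delta 1 = 0 :> SU.
Proof. by rewrite -[1]/(cls q (WCst 1)) delta_cls. Qed.

Lemma delta_Lset n x : Lset n x -> Lset (n - 2) (delta x).
Proof.
move=> Lx; suff [] : Lset n x /\ Lset (n - 2) (delta x) by [].
have L0 k : Lset k 0 by have [] := Lset_subbimod q k.
have [da dc da' dc'] := delta_gen q0.
move: n x Lx; apply: (Lset_ind (P := fun n x => Lset n x /\ Lset (n - 2) (delta x))).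
- by move=> n; rewrite delta0.
- by move=> n x y [? ?] [? ?]; rewrite deltaD; split; apply: LsetD.
- by move=> n l x [? ?]; rewrite deltaZ; split; apply: Lset_scale.
- move=> m n x y [? ?] [Ly ?]; split; first exact: LsetM.
  rewrite deltaM // (sigma_Lset Ly); apply: LsetD.
    by rewrite addrAC; apply: LsetM => //; apply: Lset_scale.
  by rewrite -addrA; apply: LsetM.
- by split; [apply: Lset01|rewrite delta1].
- by rewrite da; split=> //; apply: Lset_holo1; left.
- by rewrite dc; split=> //; apply: Lset_holo1; right.
- rewrite da'; split; first by apply: Lset_aholo1; left.
  by apply: Lset_scale; apply: Lset_holo1; right.
- rewrite dc'; split; first by apply: Lset_aholo1; right.
  by rewrite -?scaleNr; apply: Lset_scale; apply: Lset_holo1; left.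
Qed.

(** Iterating the two sphere relations shows that L_{-n} L_n contains 1. The
    bundles are therefore invertible bimodules, and y = sum (y p.1) p.2 is an
    explicit way of factoring through L_n. *)
Lemma partition_of_unity n : exists s : seq (SU * SU),
  (forall p, p \in s -> Lset (- n) p.1 /\ Lset n p.2) /\
  \sum_(p <- s) p.1 * p.2 = 1.
Proof.
have [ha hc] : holo a /\ holo c by split; [left|right].
have [ha' hc'] : aholo a' /\ aholo c' by split; [left|right].
have step (u1 v1 u2 v2 : SU) (k m : int) : u1 * v1 + u2 * v2 = 1 ->
    [/\ Lset (- k) u1, Lset (- k) u2, Lset k v1 & Lset k v2] ->
    (exists s : seq (SU * SU),
      (forall p, p \in s -> Lset (- m) p.1 /\ Lset m p.2) /\
      \sum_(p <- s) p.1 * p.2 = 1) ->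
    exists s : seq (SU * SU),
      (forall p, p \in s -> Lset (- (k + m)) p.1 /\ Lset (k + m) p.2) /\
      \sum_(p <- s) p.1 * p.2 = 1.
  move=> uv [Lu1 Lu2 Lv1 Lv2] [s [sP s1]].
  exists ([seq (p.1 * u1, v1 * p.2) | p <- s] ++
          [seq (p.1 * u2, v2 * p.2) | p <- s]); split.
    move=> p; rewrite mem_cat opprD => /orP[] /mapP[r /sP[L1 L2] ->] /=;
    by split; [rewrite addrC|]; apply: LsetM.
  rewrite big_cat /= !big_map -big_split /= -[RHS]s1; apply: eq_bigr => p _.
  by rewrite !mulrA -mulrDl -!(mulrA p.1) -mulrDr uv mulr1.
have base : exists s : seq (SU * SU),
    (forall p, p \in s -> Lset (- 0) p.1 /\ Lset 0 p.2) /\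
    \sum_(p <- s) p.1 * p.2 = 1.
  exists [:: (1, 1)]; rewrite big_seq1 mulr1; split=> // p.
  by rewrite inE oppr0 => /eqP -> /=; split; apply: Lset01.
have [[N ->]|[N ->]] : (exists N : nat, n = N) \/ (exists N : nat, n = - (N : int)).
- by case: n => [N|N]; [left; exists N|right; exists N.+1].
- elim: N => [//|N IH]; rewrite intS.
  apply: (step a a' (Q ^+ 2 *: c) c') => //.
    by rewrite -scalerAl one_holo_aholo.
  by split; [apply: Lset_holo1|apply: Lset_scale; apply: Lset_holo1
    |apply: Lset_aholo1|apply: Lset_aholo1].
- elim: N => [|N IH]; first by rewrite oppr0.
  rewrite intS opprD; apply: (step a' a c' c) => //; first exact: one_aholo_holo.
  by rewrite opprK; split; by [apply: Lset_holo1|apply: Lset_aholo1].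
Qed.

End Grading.

(** * Connections on the line bundles *)

Section Connections.
Variables (R : realType) (q : R).
Hypothesis q0 : 0 < q.
Local Notation C := R[i].
Local Notation Q := (q%:C).
Local Notation SU := (suq2 q).
Local Notation CP := (@CP R q).
Local Notation Lset := (@Lset R q).

Definition toL n (x : SU) : Lmod q n := insubd 0 x.

Lemma toLE n x : Lset n x -> Lval (toL n x) = x.
Proof. by move=> Lx; rewrite -[Lval _]/(val _) insubdK //; apply/asboolP. Qed.

Definition toCP (x : SU) : CPel q :=
  if pselect (CP x) is left Cx then MkCP Cx else MkCP (@CP1 R q).

Lemma toCPE x : CP x -> CPval (toCP x) = x.
Proof. by rewrite /toCP; case: pselect. Qed.

Lemma Lval_Lset n (x : Lmod q n) : Lset n (Lval x).
Proof. exact/asboolP/LvalP. Qed.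
Lemma Lval_sum n I (r : seq I) (F : I -> Lmod q n) :
  Lval (\sum_(i <- r) F i) = \sum_(i <- r) Lval (F i).
Proof. exact: (big_morph (@Lval R q n)). Qed.

Section Pure.
Variables m n : int.
Implicit Types (x : Lmod q m) (y : Lmod q n).

Lemma pureDl x x' y : pure (x + x') y = pure x y + pure x' y.
Proof. by rewrite -tclsD; apply/tclsP/teq_addl. Qed.
Lemma pureDr x y y' : pure x (y + y') = pure x y + pure x y'.
Proof. by rewrite -tclsD; apply/tclsP/teq_addr. Qed.
Lemma pure0l y : pure (0 : Lmod q m) y = 0.
Proof. by apply: (addrI (pure 0 y)); rewrite -pureDl !addr0. Qed.
Lemma pure0r x : pure x (0 : Lmod q n) = 0.
Proof. by apply: (addrI (pure x 0)); rewrite -pureDr !addr0. Qed.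
Lemma pure_mid x f y : pure (ract x f) y = pure x (lact f y).
Proof. exact/tclsP/teq_mid. Qed.
Lemma pure_suml I (r : seq I) (F : I -> Lmod q m) y :
  pure (\sum_(i <- r) F i) y = \sum_(i <- r) pure (F i) y.
Proof.
by apply: (big_morph (fun x => pure x y)) => [x x'|]; rewrite ?pureDl ?pure0l.
Qed.
Lemma pure_sumr I (r : seq I) (F : I -> Lmod q n) x :
  pure x (\sum_(i <- r) F i) = \sum_(i <- r) pure x (F i).
Proof.
by apply: (big_morph (fun y => pure x y)) => [y y'|]; rewrite ?pureDr ?pure0r.
Qed.
Lemma tcls_pure s : tcls s = \sum_(p <- s) pure p.1 p.2 :> tens q m n.
Proof.
elim: s => [|[x y] s IH]; first by rewrite big_nil.
by rewrite big_cons -IH -tclsD.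
Qed.
End Pure.

Section MulLeft.
Variable n : int.

Lemma balanced_left :
  balanced (fun (x : Lmod q (-2)) (y : Lmod q n) => Lval x * sigma (Lval y)).
Proof.
split=> [x1 x2 z|z x1 x2|z f x1] /=.
- by rewrite mulrDl.
- by rewrite sigmaD // mulrDr.
- by rewrite sigmaM // (sigma_CP q0 (CPvalP f)) mulrA.
Qed.

Lemma mul_left_tcls (s : ftens q (-2) n) : mul_left (tcls s) =
  \sum_(p <- s) Lval p.1 * sigma (Lval p.2) :> SU.
Proof. exact: (tsumE s balanced_left). Qed.

Lemma mul_leftD (s t : tens q (-2) n) :
  mul_left (s + t) = mul_left s + mul_left t.
Proof. by rewrite -(trepK s) -(trepK t) -tclsD !mul_left_tcls big_cat. Qed.

Lemma mul_leftZ l (t : tens q (-2) n) : mul_left (l *: t) = l *: mul_left t.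
Proof.
rewrite -(trepK t) [X in mul_left X](tscaleE l (trep t)) !mul_left_tcls.
rewrite big_map scaler_sumr.
by apply: eq_bigr => p _; rewrite /= scalerAl.
Qed.

(** The preimage is the sum of the tensors y p.1 (x) p.2 over a partition of
    unity. The powers of q compensate sigma, a scalar on each bundle. *)
Lemma mul_left_surj y : Lset (n - 2) y ->
  exists t : tens q (-2) n, mul_left t = y.
Proof.
move=> Ly; have [s [sP s1]] := partition_of_unity q0 n.
exists (tcls [seq (toL (-2) (y * p.1), toL n (Q ^ (- n) *: p.2)) | p <- s]).
rewrite mul_left_tcls big_map -[RHS]mulr1 -s1 mulr_sumr.
rewrite big_seq [RHS]big_seq; apply: eq_bigr => p /sP [L1 L2] /=.
rewrite !toLE; last 2 first.
- exact: Lset_scale.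
- have -> : -2 = n - 2 - n by rewrite addrAC subrr add0r.
  exact: LsetM.
rewrite sigmaZ // (sigma_Lset q0 L2) scalerA -expfzDr ?qC_neq0 //.
by rewrite addNr expr0z scale1r mulrA.
Qed.

(** With a partition of unity, x (x) y is the sum of the tensors
    x (y p.1) (x) p.2, since y p.1 has degree 0 and moves across; so a tensor
    depends only on its product. *)
Lemma mul_left_eq0 (t : tens q (-2) n) : mul_left t = 0 -> t = 0.
Proof.
have [s [sP s1]] := partition_of_unity q0 n.
rewrite -(trepK t); move: (trep t) => {t} u; rewrite mul_left_tcls => u0.
have {u0} u0 : \sum_(p <- u) Lval p.1 * Lval p.2 = 0.
  have : Q ^ n *: \sum_(p <- u) Lval p.1 * Lval p.2 = 0.
    rewrite -[RHS]u0 scaler_sumr; apply: eq_bigr => p _.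
    by rewrite (sigma_Lset q0 (Lval_Lset p.2)) scalerAr.
  by move/eqP; rewrite scaler_eq0 expfz_eq0 (negPf (qC_neq0 q0)) andbF => /eqP.
have split_y (x : Lmod q (-2)) (y : Lmod q n) : pure x y =
    \sum_(p <- s) pure (ract x (toCP (Lval y * p.1))) (toL n p.2).
  under eq_bigr do rewrite pure_mid.
  rewrite -pure_sumr; congr pure; apply: val_inj; rewrite /= Lval_sum.
  rewrite -[LHS]mulr1 -s1 mulr_sumr big_seq [RHS]big_seq.
  apply: eq_bigr => p /sP [L1 L2] /=; rewrite toLE // toCPE ?mulrA //.
  by apply: Lset0; rewrite -(subrr n); apply: LsetM => //; apply: Lval_Lset.
rewrite tcls_pure; under eq_bigr do rewrite split_y.
rewrite exchange_big /= big_seq big1 // => p /sP [L1 L2].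
rewrite -pure_suml (_ : \sum_(i <- u) _ = 0) ?pure0l //.
apply: val_inj; rewrite /= Lval_sum.
transitivity ((\sum_(r <- u) Lval r.1 * Lval r.2) * p.1); last first.
  by rewrite u0 mul0r.
rewrite mulr_suml; apply: eq_bigr => r _ /=; rewrite toCPE ?mulrA //.
by apply: Lset0; rewrite -(subrr n); apply: LsetM => //; apply: Lval_Lset.
Qed.

Lemma mul_left_inj : injective (@mul_left R q n).
Proof.
move=> s t st; apply/eqP; rewrite -subr_eq0; apply/eqP/mul_left_eq0.
by rewrite -scaleN1r mul_leftD mul_leftZ st scaleN1r subrr.
Qed.

Lemma mul_left_invK y : Lset (n - 2) y -> mul_left (mul_left_inv n y) = y.
Proof.
by move=> /mul_left_surj; rewrite /mul_left_inv; case: xgetP => [t _ //|H [t]]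
  /(H t).
Qed.

(** Since mul_left is injective, identities between connections may be checked
    on this product. *)
Lemma mul_left_nabla (theta : Omega q) (s : Lmod q n) :
  mul_left (nabla_ theta s) = delta (Lval s) - Lval s * Lval theta.
Proof.
rewrite -[nabla_ theta s]/(_ - _) -scaleN1r mul_leftD mul_leftZ scaleN1r.
rewrite /nabla_std /Phi mul_right_pure !mul_left_invK //.
  by apply: LsetM => //; apply: Lval_Lset.
by apply: delta_Lset => //; apply: Lval_Lset.
Qed.

Lemma mul_left_lact f (t : tens q (-2) n) :
  mul_left (tlact f t) = CPval f * mul_left t.
Proof.
rewrite -(trepK t) [X in mul_left X]tmapE; last exact: rlin_lact.
rewrite !mul_left_tcls big_map mulr_sumr.
by apply: eq_bigr => p _; rewrite /= mulrA.
Qed.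

Lemma nabla_linear theta : linear (@nabla_ R q n theta).
Proof.
move=> l x y; apply: mul_left_inj.
rewrite [RHS]mul_leftD mul_leftZ !mul_left_nabla /= deltaD // deltaZ // mulrDl.
by rewrite scalerBr scalerAl opprD addrACA.
Qed.

Lemma nabla_leibniz_theta theta : leibniz (@nabla_ R q n theta).
Proof.
move=> f s; apply: mul_left_inj.
rewrite [RHS]mul_leftD mul_left_lact mul_left_pure // !mul_left_nabla /= deltaM //.
by rewrite dbarE // mulrBr addrA mulrA.
Qed.

Lemma holomorphic_nabla theta :
  exists N : holomorphic_structure q n, N =1 nabla_ theta.
Proof.
pose m := GRing.isLinear.Build C (Lmod q n) (tens q (-2) n) *:%R
  (@nabla_ R q n theta) (nabla_linear theta).
pose f : {linear Lmod q n -> tens q (-2) n} := HB.pack (@nabla_ R q n theta) m.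
by exists (@HolomorphicStructure R q n f (nabla_leibniz_theta theta)).
Qed.

Lemma nabla_mul_eq theta1 theta2 : @nabla_ R q n theta1 =1 nabla_ theta2 ->
  forall s : Lmod q n, Lval s * Lval theta1 = Lval s * Lval theta2.
Proof.
move=> E s; have := mul_left_nabla theta1 s.
by rewrite E mul_left_nabla => /addrI /oppr_inj.
Qed.
End MulLeft.

End Connections.

(** * The representation on sequences *)

Section Representation.
Variables (R : realType) (q : R).
Hypothesis q01 : 0 < q < 1.
Let q0 : 0 < q. Proof. by case/andP: q01. Qed.
Let q1 : q < 1. Proof. by case/andP: q01. Qed.
Local Notation C := R[i].
Local Notation Q := (q%:C).
Local Notation SU := (suq2 q).
Local Notation CP := (@CP R q).
Local Notation Lset := (@Lset R q).
Local Notation a := (qa q : SU).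
Local Notation c := (qc q : SU).
Local Notation a' := (star a : SU).
Local Notation c' := (star c : SU).

(** The representation is c e_k = q^k e_k and a e_k = weight k e_{k-1} on all
    complex sequences: the matrices have finite rows, so words act without
    any convergence condition. *)
Definition weight (k : nat) : C := (Num.sqrt (1 - (q ^+ k) ^+ 2))%:C.

Lemma weight0 : weight 0 = 0.
Proof. by rewrite /weight expr0 expr1n subrr sqrtr0. Qed.

Lemma weight_sqr k : weight k * weight k = 1 - (Q ^+ k) ^+ 2.
Proof.
rewrite -!rmorphXn -(rmorph1 (real_complex R)) -rmorphB -rmorphM -expr2.
congr (_ %:C); rewrite sqr_sqrtr // subr_ge0.
by rewrite exprn_ile1 // ?exprn_ge0 ?exprn_ile1 // ltW.
Qed.

Lemma weightS_neq0 k : weight k.+1 != 0.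
Proof.
rewrite fmorph_eq0 sqrtr_eq0 -ltNge subr_gt0.
by rewrite exprn_ilt1 // ?exprn_ge0 ?ltW // exprn_ilt1 // ltW.
Qed.

Definition gact (g : gen) (v : nat -> C) (i : nat) : C :=
  match g with
  | Ga => weight i.+1 * v i.+1
  | Gas => weight i * v i.-1
  | Gc | Gcs => Q ^+ i * v i
  end.

Fixpoint wact (t : word R) (v : nat -> C) (i : nat) : C :=
  match t with
  | WGen g => gact g v i
  | WCst l => l * v i
  | WAdd t u => wact t v i + wact u v i
  | WMul t u => wact t (wact u v) i
  end.

Lemma wact_linear t l v u i :
  wact t (fun k => l * v k + u k) i = l * wact t v i + wact t u i.
Proof.
elim: t l v u i => [g|m|t IHt r IHr|t IHt r IHr] l v u i /=.
- by case: g => /=; ring.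
- by ring.
- by rewrite IHt IHr; ring.
- by rewrite -IHt; congr (wact _ _ i); apply/funext => k; rewrite IHr.
Qed.

Lemma wact0 t i : wact t (fun=> 0) i = 0.
Proof.
have := wact_linear t (-1) (fun=> 0) (fun=> 0) i.
by under eq_fun do rewrite mulr0 addr0; rewrite mulN1r addNr.
Qed.

Lemma wact_weq t u : weq q t u -> wact t = wact u.
Proof.
have Q0 := qC_neq0 q0.
elim=> {t u} //.
- move=> t u tu; apply/funext => v; apply/funext => i.
  case: tu => /=; rewrite ?exprS; try by ring.
  + by case: i => [|i]; rewrite /= ?weight0 ?exprS; ring.
  + by case: i => [|i]; rewrite /= ?weight0 ?exprS; ring.
  + case: i => [|i]; rewrite /= ?weight0 ?expr0; first by ring.
    by rewrite mulrA weight_sqr; ring.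
  + by rewrite mulrA weight_sqr [Q ^+ i.+1]exprS expr0; ring.
- by move=> t u r _ -> _ ->.
- move=> t t' u u' _ E _ E'; apply/funext => v; apply/funext => i /=.
  by rewrite E E'.
- move=> t t' u u' _ E _ E'; apply/funext => v; apply/funext => i /=.
  by rewrite E E'.
- by move=> t u; apply/funext => v; apply/funext => i /=; ring.
- by move=> t u r; apply/funext => v; apply/funext => i /=; ring.
- by move=> t; apply/funext => v; apply/funext => i /=; ring.
- by move=> t; apply/funext => v; apply/funext => i /=; ring.
- move=> t; apply/funext => v; apply/funext => i /=; rewrite mul1r //.
- move=> t u r; apply/funext => v; apply/funext => i /=.
  have := wact_linear t 1 (wact u v) (wact r v) i; rewrite mul1r => <-.
  by congr (wact _ _ i); apply/funext => k; rewrite mul1r.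
- by move=> k l; apply/funext => v; apply/funext => i /=; ring.
- by move=> k l; apply/funext => v; apply/funext => i /=; ring.
- move=> k t; apply/funext => v; apply/funext => i /=.
  have := wact_linear t k v (fun=> 0) i; rewrite wact0 addr0 => <-.
  by congr (wact t _ i); apply/funext => j; rewrite addr0.
Qed.

Definition act (x : SU) := wact (rep x).

Lemma act_cls t : act (cls q t) = wact t.
Proof. exact/wact_weq/rep_cls. Qed.

Lemma act_linear x l v u i :
  act x (fun k => l * v k + u k) i = l * act x v i + act x u i.
Proof. exact: wact_linear. Qed.

Lemma actM x y v : act (x * y) v = act x (act y v).
Proof. by rewrite -(repK x) -(repK y) -clsM !act_cls. Qed.
Lemma actD x y v i : act (x + y) v i = act x v i + act y v i.
Proof. by rewrite -(repK x) -(repK y) -clsD !act_cls. Qed.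
Lemma actZ l x v i : act (l *: x) v i = l * act x v i.
Proof. by rewrite -(repK x) -clsZ !act_cls. Qed.
Lemma act1 v i : act 1 v i = v i.
Proof. by rewrite -[1]/(cls q (WCst 1)) act_cls /= mul1r. Qed.
Lemma act0 v i : act 0 v i = 0.
Proof. by rewrite -[0]/(cls q (WCst 0)) act_cls /= mul0r. Qed.
Lemma actB x y v i : act (x - y) v i = act x v i - act y v i.
Proof. by rewrite actD -scaleN1r actZ mulN1r. Qed.

Lemma act_a v i : act a v i = weight i.+1 * v i.+1.
Proof. by rewrite act_cls. Qed.
Lemma act_c v i : act c v i = Q ^+ i * v i.
Proof. by rewrite act_cls. Qed.
Lemma act_a' v i : act a' v i = weight i * v i.-1.
Proof. by rewrite star_cls act_cls. Qed.
Lemma act_c' v i : act c' v i = Q ^+ i * v i.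
Proof. by rewrite star_cls act_cls. Qed.
Definition act_gen := (act_a, act_c, act_a', act_c').

Definition basis (j k : nat) : C := (k == j)%:R.

Definition entry (x : SU) i j : C := act x (basis j) i.

Lemma act_local x i : exists K, forall v u, (forall k, (k < K)%N -> v k = u k) ->
  act x v i = act x u i.
Proof.
rewrite /act; elim: (rep x) i => [g|m|t IHt r IHr|t IHt r IHr] i /=.
- exists i.+2 => v u E; case: g => /=; rewrite E //.
  by case: i {E} => // i; apply: (leq_trans (ltnSn _)); rewrite leqW.
- by exists i.+1 => v u E; rewrite E.
- have [K Kt] := IHt i; have [K' Kr] := IHr i; exists (maxn K K') => v u E.
  rewrite (Kt v u) ?(Kr v u) // => k kK; apply: E.
    by rewrite leq_max kK orbT.
  by rewrite leq_max kK.
- have [K Kt] := IHt i; have /choice [F KF] := IHr.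
  exists (\max_(k < K) F k) => v u E; apply: Kt => k kK; apply: KF => l lF.
  apply: E; apply: leq_trans lF _.
  exact: (leq_bigmax_cond (F := fun k : 'I_K => F k) (Ordinal kK)).
Qed.

Lemma act_sum x (F : nat -> C) K i :
  act x (fun k => \sum_(j < K) F j * basis j k) i = \sum_(j < K) F j * entry x i j.
Proof.
elim: K => [|K IH].
  rewrite big_ord0; under eq_fun do rewrite big_ord0.
  exact: wact0.
rewrite big_ord_recr /= -IH addrC -act_linear; congr (act x _ i).
by apply/funext => k; rewrite big_ord_recr addrC.
Qed.

Lemma act_entries x i : exists K0, forall K, (K0 <= K)%N -> forall v,
  act x v i = \sum_(j < K) entry x i j * v j.
Proof.
have [K0 H] := act_local x i; exists K0 => K KK v.
transitivity (act x (fun k => \sum_(j < K) v j * basis j k) i).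
  apply: H => k kK.
  rewrite (bigD1 (Ordinal (leq_trans kK KK))) //= /basis eqxx mulr1.
  rewrite big1 ?addr0 // => j; rewrite -val_eqE /= eq_sym => /negPf ->.
  by rewrite mulr0.
by rewrite act_sum; apply: eq_bigr => j _; rewrite mulrC.
Qed.

Lemma entryM x y i : exists K0, forall K, (K0 <= K)%N -> forall j,
  entry (x * y) i j = \sum_(k < K) entry x i k * entry y k j.
Proof.
by have [K0 H] := act_entries x i; exists K0 => K KK j; rewrite /entry actM (H K).
Qed.

Lemma act_finite x v : (exists K, forall k, (K <= k)%N -> v k = 0) ->
  exists K, forall k, (K <= k)%N -> act x v k = 0.
Proof.
rewrite /act; elim: (rep x) v => [g|m|t IHt r IHr|t IHt r IHr] v [K Kv] /=.
- exists K.+1 => k Kk; case: g => /=; rewrite Kv ?mulr0 //.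
  + by rewrite (leq_trans _ (leqW Kk)) // leqW.
  + by case: k Kk.
  + exact: ltnW.
  + exact: ltnW.
- by exists K => k Kk; rewrite Kv ?mulr0.
- have [K1 H1] := IHt v (ex_intro _ _ Kv).
  have [K2 H2] := IHr v (ex_intro _ _ Kv).
  exists (maxn K1 K2) => k; rewrite geq_max => /andP [? ?].
  by rewrite H1 ?H2 ?addr0.
- exact/IHt/IHr/(ex_intro _ _ Kv).
Qed.

Lemma entry_column x j : exists K, forall i, (K <= i)%N -> entry x i j = 0.
Proof.
apply: act_finite; exists j.+1 => k jk; rewrite /basis.
by rewrite gtn_eqF.
Qed.

Lemma entryD x y i j : entry (x + y) i j = entry x i j + entry y i j.
Proof. exact: actD. Qed.
Lemma entryZ l x i j : entry (l *: x) i j = l * entry x i j.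
Proof. exact: actZ. Qed.
Lemma entryB x y i j : entry (x - y) i j = entry x i j - entry y i j.
Proof. exact: actB. Qed.
Lemma entry1 i j : entry 1 i j = (i == j)%:R.
Proof. exact: act1. Qed.

Lemma conjC_real (x : R) : Num.conj (x%:C) = x%:C :> C.
Proof. by apply: CrealP; apply/complex_realP; exists x. Qed.

Lemma entry_star x i j : entry (star x) i j = Num.conj (entry x j i).
Proof.
rewrite -(repK x) star_cls; elim: (rep x) i j => [g|l|t IHt r IHr|t IHt r IHr] i j /=.
- have cQ k : Num.conj (Q ^+ k) = Q ^+ k by rewrite rmorphXn /= conjC_real.
  have cw k : Num.conj (weight k) = weight k by rewrite conjC_real.
  rewrite /entry !act_cls; case: g => /=; rewrite rmorphM /= ?cQ ?cw /basis rmorph_nat.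
  + case: i => [|i]; rewrite ?weight0 /= ?mul0r ?eqn0Ngt ?mulr0 // eqSS eq_sym.
    by case: eqVneq => [->|]; rewrite ?mulr0.
  + case: j => [|j]; rewrite ?weight0 /= ?mul0r ?mulr0 // eqSS eq_sym.
    by case: eqVneq => [->|]; rewrite ?mulr0.
  + by rewrite eq_sym; case: eqVneq => [->|]; rewrite ?mulr0.
  + by rewrite eq_sym; case: eqVneq => [->|]; rewrite ?mulr0.
- rewrite !clsC !entryZ !entry1 rmorphM rmorph_nat eq_sym //.
- by rewrite !clsD !entryD rmorphD IHt IHr.
- rewrite !clsM.
  have [K1 H1] := entryM (cls q (wstar r)) (cls q (wstar t)) i.
  have [K2 H2] := entryM (cls q t) (cls q r) j.
  rewrite (H1 (maxn K1 K2) (leq_maxl _ _)) (H2 (maxn K1 K2) (leq_maxr _ _)).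
  rewrite rmorph_sum; apply: eq_bigr => k _.
  by rewrite rmorphM /= IHt IHr mulrC.
Qed.

(** In the representation c is invertible, and coord is the operator
    kappa (star c)^-1 a. *)
Definition kappa : C := - ((Num.sqrt q)^-1)%:C / (1 - Q ^+ 2).

Definition coord (v : nat -> C) (i : nat) : C :=
  kappa * weight i.+1 * Q ^- i * v i.+1.

Lemma one_sub_Q2_neq0 : 1 - Q ^+ 2 != 0.
Proof.
rewrite -rmorphXn -(rmorph1 (real_complex R)) -rmorphB fmorph_eq0 gt_eqF //.
by rewrite subr_gt0 exprn_ilt1 // ltW.
Qed.

Lemma kappa_neq0 : kappa != 0.
Proof.
rewrite mulf_neq0 ?invr_neq0 ?one_sub_Q2_neq0 // oppr_eq0 fmorph_eq0 invr_eq0.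
by rewrite sqrtr_eq0 -ltNge.
Qed.

(** Both sides are derivations of CP, so it is enough to compare them on the
    three generators. The scalar kappa is fixed by the generator c c'. *)
Lemma delta_commutator f : CP f -> forall v i,
  act (delta f) v i = act f (coord v) i - coord (act f v) i.
Proof.
move=> Cf; suff [] : CP f /\ forall v i,
  act (delta f) v i = act f (coord v) i - coord (act f v) i by [].
move: f Cf; apply: CP_ind; first split=> /=.
- split; first exact: CP1.
  by move=> v i; rewrite delta1 // act0 /coord !act1 subrr.
- move=> f g [? Hf] [? Hg]; split; first exact: CPD.
  by move=> v i; rewrite deltaD // actD Hf Hg actD /coord !actD; ring.
- move=> l f [? Hf]; split; first exact: CPZ.
  by move=> v i; rewrite deltaZ // actZ Hf !actZ /coord actZ; ring.
- move=> f g [? Hf] [Cg Hg]; split; first exact: CPM.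
  move=> v i; rewrite deltaM // (sigma_CP q0 Cg) actD !actM Hf.
  have -> : act (delta g) v =
      (fun k => (-1) * coord (act g v) k + act g (coord v) k).
    by apply/funext => k; rewrite Hg; ring.
  by rewrite act_linear; ring.
have Q0 := qC_neq0 q0.
have [da dc da' dc'] := delta_gen q0.
pose S : C := (Num.sqrt q)%:C.
have S0 : S != 0 by rewrite fmorph_eq0 sqrtr_eq0 -ltNge.
have SV : ((Num.sqrt q)^-1)%:C = S^-1 by rewrite fmorphV.
have QS : Q = S * S by rewrite -rmorphM -expr2 sqr_sqrtr // ltW.
have D0 : 1 - Q * Q != 0 by rewrite -expr2 one_sub_Q2_neq0.
have P0 i : Q ^+ i != 0 by rewrite expf_neq0.
move=> f gf; split; first exact: sub_gen_smallest.
move=> v i; have W := weight_sqr i; have W' := weight_sqr i.+1.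
move: (P0 i); case: gf => [[]|] ->;
  rewrite deltaM // ?da ?dc ?da' ?dc' mul0r add0r -scalerAr actZ
    ?SV -/S !actM /coord !act_gen /kappa SV ?exprS ?expr0 ?mulr1 => Pi0.
- by field; rewrite ?P0 ?Q0 ?D0 ?S0.
- transitivity (S^-1 / (1 - Q * Q) * Q * v i *
    (weight i.+1 * weight i.+1 - weight i * weight i)).
    by rewrite W W' [Q ^+ i.+1]exprS; move: S0 D0; rewrite QS => S0 D0; field; rewrite S0 D0.
  case: i W W' Pi0 => [|i] W W' Pi0 /=; first by rewrite weight0 expr0; field; rewrite S0 D0.
  by rewrite exprS; field; rewrite ?P0 ?Q0 ?D0 ?S0.
- by field; rewrite ?P0 ?Q0 ?D0 ?S0.
Qed.

End Representation.

(** * Spanning the quantum projective line *)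

Section CPbasis.
Variables (R : realType) (q : R).
Hypothesis q0 : 0 < q.
Local Notation C := R[i].
Local Notation Q := (q%:C).
Local Notation SU := (suq2 q).
Local Notation CP := (@CP R q).
Local Notation a := (qa q : SU).
Local Notation c := (qc q : SU).
Local Notation a' := (star a : SU).
Local Notation c' := (star c : SU).
Local Notation B0 := (c * c').
Local Notation Bm := (a * c').
Local Notation Bp := (c * a').

Lemma gens_B0_comm : [/\ a * B0 = Q ^+ 2 *: (B0 * a), a' * B0 = Q ^- 2 *: (B0 * a'),
  c * B0 = B0 * c & c' * B0 = B0 * c'].
Proof.
have [[r1 r2 r3 r4] [r5 r6 r7]] := normal_order q0.
split.
- by rewrite mulrA r1 -scalerAl -[c * a * c']mulrA r2 -scalerAr scalerA mulrA.
- by rewrite mulrA r3 -scalerAl -[c * a' * c']mulrA r4 -scalerAr scalerA mulrA -exprVn.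
- by rewrite -mulrA r5.
- by rewrite !mulrA r5.
Qed.

Lemma CP_gens_comm : [/\ Bm * B0 = Q ^+ 2 *: (B0 * Bm),
  Bp * B0 = Q ^- 2 *: (B0 * Bp),
  Bp * Bm = B0 - B0 * B0 & Bm * Bp = Q ^+ 2 *: B0 - Q ^+ 4 *: (B0 * B0)].
Proof.
have [_ [r5 r6 r7]] := normal_order q0.
have [e1 e2 e3 e4] := gens_B0_comm; split.
- by rewrite -mulrA e4 mulrA e1 -scalerAl !mulrA.
- by rewrite -mulrA e2 -scalerAr [c * (_ * a')]mulrA e3 !mulrA.
- rewrite -mulrA [a' * _]mulrA r6 mulrBl mul1r mulrBr; congr (_ - _).
  by rewrite -!mulrA [c' * (c * c')]e4 !mulrA.
- rewrite -mulrA [c' * _]mulrA r5 [a * (B0 * a')]mulrA e1 -scalerAl -[B0 * a * a']mulrA r7.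
  by rewrite mulrBr mulr1 scalerBr -scalerAr scalerA -exprD.
Qed.

(** The span of these monomials contains 1 and is stable under left
    multiplication by the generators of CP. *)
Lemma CP_span (P : SU -> Prop) :
  (forall x y, P x -> P y -> P (x + y)) -> (forall l x, P x -> P (l *: x)) ->
  (forall n m, P (B0 ^+ n * Bm ^+ m)) -> (forall n m, P (B0 ^+ n * Bp ^+ m)) ->
  forall f, CP f -> P f.
Proof.
move=> PD PZ Pm Pp f Cf.
pose V := smallest [set S : set SU |
  [/\ forall x y, S x -> S y -> S (x + y), forall l x, S x -> S (l *: x),
      forall n m, S (B0 ^+ n * Bm ^+ m) & forall n m, S (B0 ^+ n * Bp ^+ m)]]
  set0.
have VP : V `<=` P by apply: smallest_sub => //; split.
have [VD VZ Vm Vp] : [/\ forall x y, V x -> V y -> V (x + y),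
    forall l x, V x -> V (l *: x),
    forall n m, V (B0 ^+ n * Bm ^+ m) & forall n m, V (B0 ^+ n * Bp ^+ m)].
  split.
  - move=> x y Vx Vy S HS; have [[+ _ _ _] _] := HS.
    by apply; [apply: Vx|apply: Vy].
  - by move=> l x Vx S HS; have [[_ + _ _] _] := HS; apply; apply: Vx.
  - by move=> n m S HS; have [[_ _ + _] _] := HS; apply.
  - by move=> n m S HS; have [[_ _ _ +] _] := HS; apply.
apply: VP; suff : forall v, V v -> V (f * v).
  by rewrite -[V f]/(V f) -{2}[f]mulr1 => /(_ 1); apply; have := Vm 0%N 0%N;
    rewrite !expr0 mulr1.
have [e1 e2 e3 e4] := CP_gens_comm.
have VB x y : V x -> V y -> V (x - y).
  by move=> Vx Vy; rewrite -scaleN1r; apply: VD => //; apply: VZ.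
move: f Cf; apply: (CP_ind (P := [set f | forall v, V v -> V (f * v)])).
  split=> /=.
  - by move=> v Vv; rewrite mul1r.
  - by move=> f g Hf Hg v Vv; rewrite mulrDl; apply: VD; auto.
  - by move=> l f Hf v Vv; rewrite -scalerAl; apply: (VZ); auto.
  - by move=> f g Hf Hg v Vv; rewrite -mulrA; auto.
have Vind f : (forall n m, V (f * (B0 ^+ n * Bm ^+ m))) ->
    (forall n m, V (f * (B0 ^+ n * Bp ^+ m))) -> forall v, V v -> V (f * v).
  move=> Hm Hp; apply: smallest_sub => //; split=> //=.
  - by move=> x y; rewrite mulrDr; apply: VD.
  - by move=> l x; rewrite -scalerAr; apply: VZ.
have VB0 v : V v -> V (B0 * v).
  apply: Vind => n m; rewrite mulrA -exprS; [exact: Vm|exact: Vp].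
have VB0n n v : V v -> V (B0 ^+ n * v).
  by elim: n => [|n IH] Vv; rewrite ?expr0 ?mul1r // exprS -mulrA; auto.
have Vm0 m : V (Bm ^+ m) by have := Vm 0%N m; rewrite expr0 mul1r.
have Vp0 m : V (Bp ^+ m) by have := Vp 0%N m; rewrite expr0 mul1r.
move=> f [[]|] -> //=; apply: Vind => n m.
- by rewrite mulrA (comm_powl _ e1) -scalerAl -mulrA -exprS; apply: VZ.
- rewrite mulrA (comm_powl _ e1) -scalerAl -mulrA; apply: (VZ); apply: (VB0n).
  case: m => [|m]; first by rewrite expr0 mulr1; apply: (Vm0 1%N).
  rewrite exprS mulrA e4 mulrBl -!scalerAl -[B0 * B0 * _]mulrA.
  by apply: (VB); apply: (VZ); do ?apply: (VB0).
- rewrite mulrA (comm_powl _ e2) -scalerAl -mulrA; apply: (VZ); apply: (VB0n).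
  case: m => [|m]; first by rewrite expr0 mulr1; apply: (Vp0 1%N).
  rewrite exprS mulrA e3 mulrBl -[B0 * B0 * _]mulrA.
  by apply: (VB); do ?apply: (VB0).
- by rewrite mulrA (comm_powl _ e2) -scalerAl -mulrA -exprS; apply: VZ.
Qed.

End CPbasis.

(** * Left invariance against a triangular representation *)

Section LeftInvariance.
Variables (R : realType) (q : R).
Hypothesis q0 : 0 < q.
Local Notation C := R[i].
Local Notation Q := (q%:C).
Local Notation SU := (suq2 q).
Local Notation a := (qa q : SU).
Local Notation c := (qc q : SU).
Local Notation a' := (star a : SU).
Local Notation c' := (star c : SU).

Definition mx2 (x y z : C) : 'M[C]_2 :=
  \matrix_(i, j) (if i == 0 then if j == 0 then x else y
                  else if j == 0 then 0 else z).

(** An upper triangular representation: its diagonal entries are characters, and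
    its entry (0, 1) is a skew derivation, which plays the part of a root
    vector of the quantized enveloping algebra. *)
Definition tri_gen (g : gen) : 'M[C]_2 :=
  match g with
  | Ga => mx2 Q 0 1 | Gas => mx2 Q^-1 0 1
  | Gc => mx2 0 0 0 | Gcs => mx2 0 1 0
  end.

Lemma mx2M x y z x' y' z' :
  mx2 x y z * mx2 x' y' z' = mx2 (x * x') (x * y' + y * z') (z * z').
Proof.
apply/matrixP => i j; rewrite !mxE !big_ord_recl big_ord0 addr0 !mxE /=.
by case: ifP => _; case: ifP => _; rewrite ?(mul0r, mulr0, addr0, add0r).
Qed.
Lemma mx2D x y z x' y' z' :
  mx2 x y z + mx2 x' y' z' = mx2 (x + x') (y + y') (z + z').
Proof.
by apply/matrixP => i j; rewrite !mxE; case: ifP => _; case: ifP => _;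
  rewrite ?addr0.
Qed.
Lemma mx2Z l x y z : l *: mx2 x y z = mx2 (l * x) (l * y) (l * z).
Proof.
by apply/matrixP => i j; rewrite !mxE; case: ifP => _; case: ifP => _;
  rewrite ?mulr0.
Qed.
Lemma mx21 : 1 = mx2 1 0 1.
Proof.
apply/matrixP => i j; rewrite !mxE.
by case: i => [[|[|i]] Hi] //; case: j => [[|[|j]] Hj].
Qed.

Lemma tri_rel : @gen_rel R q _ tri_gen.
Proof.
have Q0 := qC_neq0 q0.
move=> u v [] /=; rewrite ?mx21 ?(mx2M, mx2Z, mx2D, mulr1, mul1r, mulr0,
  mul0r, addr0, add0r, mulfV Q0, mulVf Q0) //.
Qed.

Definition tri : SU -> 'M[C]_2 := suq2_ext tri_gen.

Lemma tri_cls t : tri (cls q t) = weval tri_gen t.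
Proof. exact: (suq2_extE tri_rel). Qed.
Lemma tri_linear : linear tri.
Proof. exact: (suq2_ext_lrmorphism tri_rel).1. Qed.
Lemma triZ l x : tri (l *: x) = l *: tri x.
Proof.
have t0 : tri 0 = 0.
  by have := tri_linear (-1) 0 0; rewrite scaler0 addr0 scaleN1r addNr.
by have := tri_linear l x 0; rewrite t0 !addr0.
Qed.
Lemma triM x y : tri (x * y) = tri x * tri y.
Proof. by have [_ []] := suq2_ext_lrmorphism tri_rel. Qed.
Lemma tri1 : tri 1 = 1.
Proof. by have [_ []] := suq2_ext_lrmorphism tri_rel. Qed.

(** The coproduct with the entry (i, j) of tri applied to its first leg. Words
    suffice, because left invariance is a statement about words. *)
Definition translate (t : word R) (i j : 'I_2) : SU :=
  \sum_(p <- coprod q t) tri (cls q p.1) i j *: cls q p.2.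

Lemma translateM t u i j : translate (WMul t u) i j =
  \sum_k translate t i k * translate u k j.
Proof.
rewrite /translate /= big_allpairs_dep /=.
under [RHS]eq_bigr do rewrite mulr_suml.
rewrite [RHS]exchange_big; apply: eq_bigr => p _.
under [RHS]eq_bigr do rewrite mulr_sumr.
rewrite [RHS]exchange_big; apply: eq_bigr => r _ /=.
rewrite !clsM triM mxE scaler_suml; apply: eq_bigr => k _.
by rewrite -scalerAl -scalerAr scalerA.
Qed.

Lemma translate_triangular t :
  translate t 1 0 = 0 /\ translate t 1 1 = cls q t.
Proof.
elim: t => [g|l|t [t0 t1] u [u0 u1]|t [t0 t1] u [u0 u1]].
- by rewrite /translate; case: g; split;
    rewrite /coprod big_cons big_seq1 ?clsZ ?triZ !tri_cls /= ?mx2Z !mxE /=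
      ?(mulr0, scale0r, addr0, add0r, scale1r).
- by rewrite /translate; split; rewrite /= big_seq1 tri_cls /= mx21 mx2Z !mxE /=
    ?mulr1 ?mulr0 ?scale0r ?clsC ?scale1r.
- split; rewrite /translate /= big_cat /= -!/(translate _ _ _).
    by rewrite t0 u0 addr0.
  by rewrite t1 u1 clsD.
- by rewrite !translateM !big_ord_recl !big_ord0 /= !addr0 -!/(1 : 'I_2);
  rewrite (_ : lift _ _ = 1) ?t0 ?u0 ?t1 ?u1 ?mulr0 ?mul0r ?add0r ?clsM //; apply/val_inj.
Qed.

Lemma translateM00 t u :
  translate (WMul t u) 0 0 = translate t 0 0 * translate u 0 0.
Proof.
rewrite translateM !big_ord_recl big_ord0 /= addr0 (_ : lift _ _ = 1); last exact/val_inj.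
by rewrite (translate_triangular u).1 mulr0 addr0.
Qed.

Lemma translateM01 t u : translate (WMul t u) 0 1 =
  translate t 0 0 * translate u 0 1 + translate t 0 1 * cls q u.
Proof.
rewrite translateM !big_ord_recl big_ord0 /= addr0 (_ : lift _ _ = 1); last exact/val_inj.
by rewrite (translate_triangular u).2.
Qed.

Lemma translate_gen :
  [/\ translate (WGen _ Ga) 0 0 = Q *: a, translate (WGen _ Gc) 0 0 = Q^-1 *: c,
      translate (WGen _ Gas) 0 0 = Q^-1 *: a' & translate (WGen _ Gcs) 0 0 = Q *: c'] /\
  [/\ translate (WGen _ Ga) 0 1 = - Q *: c, translate (WGen _ Gc) 0 1 = 0,
      translate (WGen _ Gas) 0 1 = 0 & translate (WGen _ Gcs) 0 1 = a'].
Proof.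
rewrite !star_cls; split; split;
  by rewrite /translate /coprod big_cons big_seq1 ?clsZ ?triZ !tri_cls /= ?mx2Z !mxE /=
    ?(mulr0, mulr1, scale0r, addr0, add0r, scale1r).
Qed.

End LeftInvariance.

(** * The Haar state on the quantum projective line *)

Section Haar.
Variables (R : realType) (q : R).
Hypothesis q01 : 0 < q < 1.
Let q0 : 0 < q. Proof. by case/andP: q01. Qed.
Let q1 : q < 1. Proof. by case/andP: q01. Qed.
Local Notation C := R[i].
Local Notation Q := (q%:C).
Local Notation SU := (suq2 q).
Local Notation CP := (@CP R q).
Local Notation Lset := (@Lset R q).
Local Notation qa := (qa q : SU).
Local Notation qc := (qc q : SU).
Local Notation B0 := (qc * star qc).
Local Notation Bm := (qa * star qc).
Local Notation Bp := (qc * star qa).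
Variables (A : cstarAlgType R) (a c : A).
Hypothesis rel : suq2_rel q a c.
Variable h : A -> C.
Hypothesis haar : haar_state q a c h.
Local Notation iota := (@iota_suq2 R q A a c).

Lemma iota_linear : linear iota.
Proof. by have [] := iota_suq2P rel. Qed.
Lemma iotaM x y : iota (x * y) = iota x * iota y.
Proof. by have [_ [_ +] _ _ _] := iota_suq2P rel; apply. Qed.
Lemma iota1 : iota 1 = 1.
Proof. by have [_ [+ _] _ _ _] := iota_suq2P rel. Qed.
Lemma iota_star x : iota (star x) = star (iota x).
Proof. by have [_ _ + _ _] := iota_suq2P rel; apply. Qed.
Lemma iota0 : iota 0 = 0.
Proof. by have := iota_linear (-1) 0 0; rewrite scaler0 addr0 scaleN1r addNr. Qed.
Lemma iotaZ l x : iota (l *: x) = l *: iota x.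
Proof. by have := iota_linear l x 0; rewrite iota0 !addr0. Qed.
Lemma iotaD x y : iota (x + y) = iota x + iota y.
Proof. by have := iota_linear 1 x y; rewrite !scale1r. Qed.
Lemma iotaB x y : iota (x - y) = iota x - iota y.
Proof. by rewrite -scaleN1r iotaD iotaZ scaleN1r. Qed.

Lemma h_linear : scalar h. Proof. by have [[]] := haar. Qed.
Lemma h_ge0 x : 0 <= h (star x * x). Proof. by have [[_ + _ _] _] := haar; apply. Qed.
Lemma h1 : h 1 = 1. Proof. by have [[]] := haar. Qed.
Lemma h_bound x : Normc.normc (h x) <= cnorm x.
Proof. by have [[_ _ _ +] _] := haar; apply. Qed.
Lemma h0 : h 0 = 0.
Proof. by have := h_linear (-1) 0 0; rewrite scaler0 addr0 mulN1r addNr. Qed.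
Lemma hZ l x : h (l *: x) = l * h x.
Proof. by have := h_linear l x 0; rewrite h0 !addr0. Qed.
Lemma hD x y : h (x + y) = h x + h y.
Proof. by have := h_linear 1 x y; rewrite scale1r mul1r. Qed.
Lemma hB x y : h (x - y) = h x - h y.
Proof. by rewrite -scaleN1r hD hZ mulN1r. Qed.

Local Notation hi x := (h (iota x)).

Lemma haar_translate t i j :
  hi (translate q t i j) = hi (cls q t) * (i == j)%:R.
Proof.
have := congr1 (fun x => tri x i j) (haar.2 t); rewrite triZ // tri1 // !mxE => <-.
rewrite /translate.
rewrite (big_morph (@tri R q) (id1 := 0) (op1 := +%R)); last 2 first.
- by move=> x y; have := tri_linear q0 1 x y; rewrite !scale1r.
- by have := tri_linear q0 (-1) 0 0; rewrite scaler0 addr0 scaleN1r addNr.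
rewrite summxE (big_morph iota (id1 := 0) (op1 := +%R) iotaD iota0).
rewrite (big_morph h (id1 := 0) (op1 := +%R) hD h0).
by apply: eq_bigr => p _; rewrite iotaZ hZ triZ // mxE mulrC.
Qed.

Fixpoint wexp (t : word R) n := if n is m.+1 then WMul t (wexp t m) else WCst 1.

Lemma cls_wexp t n : cls q (wexp t n) = cls q t ^+ n.
Proof.
by elim: n => [|n IH] //=; rewrite clsM IH exprS.
Qed.

Let wB0 : word R := WMul (WGen _ Gc) (WGen _ Gcs).
Let wBm : word R := WMul (WGen _ Ga) (WGen _ Gcs).
Let wBp : word R := WMul (WGen _ Gc) (WGen _ Gas).

Lemma cls_wB : [/\ cls q wB0 = B0, cls q wBm = Bm & cls q wBp = Bp].
Proof. by rewrite !star_cls; split; rewrite clsM. Qed.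

Lemma translate_one i j : translate q (WCst 1) i j = (i == j)%:R.
Proof.
rewrite /translate big_seq1 /= -[cls q _]/(1 : SU) tri1 // mxE.
by case: (i == j); rewrite ?scale1r ?scale0r.
Qed.

Lemma translate_exp t l n : translate q t 0 0 = l *: cls q t ->
  translate q (wexp t n) 0 0 = l ^+ n *: cls q t ^+ n.
Proof.
move=> tE; elim: n => [|n IH] /=; first by rewrite translate_one !expr0 scale1r.
by rewrite translateM00 // tE IH -scalerAl -scalerAr scalerA !exprS.
Qed.

Lemma translate_B : [/\ translate q wB0 0 0 = B0,
   translate q wBm 0 0 = Q ^+ 2 *: Bm & translate q wBp 0 0 = Q ^- 2 *: Bp].
Proof.
have Q0 := qC_neq0 q0; have [[ea ec ea' ec'] _] := translate_gen q0.
split; rewrite translateM00 // ?ea ?ec ?ea' ?ec' -scalerAl -scalerAr scalerA //.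
by rewrite mulVf ?scale1r.
by rewrite -exprVn.
Qed.

Lemma translate_B01 : [/\ translate q wB0 0 1 = Q^-1 *: Bp &
   translate q wBm 0 1 = Q *: 1 - (Q * (1 + Q ^+ 2)) *: B0].
Proof.
have Q0 := qC_neq0 q0; have [[ea ec ea' ec'] [da dc da' dc']] := translate_gen q0.
have [_ [r5 r6 r7]] := normal_order q0.
split; rewrite translateM01 // ?ea ?ec ?ea' ?ec' ?da ?dc ?da' ?dc' ?mul0r ?addr0.
  by rewrite -scalerAl.
rewrite -[cls _ _]/(cls q (wstar (WGen R Gc))) -star_cls -!scalerAl r7 scalerBr scalerA.
by rewrite -addrA -scaleNr -scalerDl; congr (_ + _); rewrite -scaleNr; congr (_ *: _); ring.
Qed.

(** The diagonal translation fixes B0 and rescales Bm and Bp by powers of q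
    different from 1. *)
Lemma haar_offdiag n m :
  hi (B0 ^+ n * Bm ^+ m.+1) = 0 /\ hi (B0 ^+ n * Bp ^+ m.+1) = 0.
Proof.
have [b0 bm bp] := cls_wB; have [k0 km kp] := translate_B.
have Q0 := qC_neq0 q0.
have kB0 : translate q (wexp wB0 n) 0 0 = B0 ^+ n.
  by rewrite (translate_exp (l := 1)) ?expr1n ?scale1r b0.
have P k : (0 < k)%N -> Q ^+ k != 1.
  move=> k0'; rewrite -rmorphXn -(rmorph1 (real_complex R)) (inj_eq (fmorph_inj _)).
  by rewrite lt_eqF // exprn_ilt1 ?ltW // -lt0n.
split.
- have := haar_translate (WMul (wexp wB0 n) (wexp wBm m.+1)) 0 0.
  rewrite translateM00 // kB0 (translate_exp (l := Q ^+ 2)) ?bm // -scalerAr.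
  rewrite iotaZ hZ clsM !cls_wexp b0 bm eqxx mulr1 => /eqP.
  rewrite -subr_eq0 -[X in _ - X]mul1r -mulrBl mulf_eq0 subr_eq0 -exprM.
  by rewrite (negPf (P _ _)) // => /eqP.
- have := haar_translate (WMul (wexp wB0 n) (wexp wBp m.+1)) 0 0.
  rewrite translateM00 // kB0 (translate_exp (l := Q ^- 2)) ?bp // -scalerAr.
  rewrite iotaZ hZ clsM !cls_wexp b0 bp eqxx mulr1 => /eqP.
  rewrite -subr_eq0 -[X in _ - X]mul1r -mulrBl mulf_eq0 subr_eq0 exprVn -exprM.
  by rewrite -(inj_eq invr_inj) invr1 invrK (negPf (P _ _)) // => /eqP.
Qed.

Lemma one_subQX_neq0 n : 1 - Q ^+ n.+1 != 0.
Proof.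
rewrite -rmorphXn -(rmorph1 (real_complex R)) -rmorphB fmorph_eq0 subr_eq0.
by rewrite eq_sym lt_eqF // exprn_ilt1 // ltW.
Qed.

(** The off-diagonal translation maps B0^n Bm to a combination of B0^n and
    B0^(n+1), on which h vanishes: this is a recursion for the moments. *)
Lemma haar_moment n : (1 - Q ^+ (2 * n.+1)) * hi (B0 ^+ n) = 1 - Q ^+ 2.
Proof.
have Q0 := qC_neq0 q0.
have [b0 bm bp] := cls_wB; have [k0 km kp] := translate_B.
have [d0 dm] := translate_B01.
have [e1 e2 e3 e4] := CP_gens_comm q0.
have kB0 k : translate q (wexp wB0 k) 0 0 = B0 ^+ k.
  by rewrite (translate_exp (l := 1)) ?expr1n ?scale1r b0.
(* The closed form of the sum of q^(-2j-1) over j < k. *)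
pose e k : C := Q * (1 - Q ^+ (2 * k)) / ((1 - Q ^+ 2) * Q ^+ (2 * k)).
have dB0 k : translate q (wexp wB0 k) 0 1 * Bm = e k *: (B0 ^+ k - B0 ^+ k.+1).
  elim: k => [|k IH].
    by rewrite /= translate_one mul0r /e muln0 expr0 subrr mulr0 mul0r scale0r.
  rewrite /= translateM01 // k0 d0 cls_wexp b0 mulrDl -mulrA IH.
  rewrite -!scalerAl (comm_powl _ e2) -scalerAl -[B0 ^+ k * Bp * Bm]mulrA e3.
  rewrite -scalerAr mulrBr -!exprS.
  have -> : B0 ^+ k * (B0 - B0 * B0) = B0 ^+ k.+1 - B0 ^+ k.+2.
    by rewrite mulrBr -[B0 * B0]expr2 -exprSr -exprD addn2.
  rewrite scalerA -scalerDl; congr (_ *: _).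
  rewrite /e mulnS exprD exprVn -exprM; field.
  by rewrite Q0 expf_neq0 // one_subQX_neq0.
elim: n => [|n IH]; first by rewrite expr0 iota1 h1 mulr1.
have := haar_translate (WMul (wexp wB0 n) wBm) 0 1.
rewrite translateM01 // kB0 dm bm dB0 mulr0 mulrBr -!scalerAr mulr1 -exprSr.
rewrite iotaD iotaB !iotaZ iotaB hD hB !hZ hB => E.
have {}E : (Q * (1 + Q ^+ 2) + e n) * hi (B0 ^+ n.+1) = (Q + e n) * hi (B0 ^+ n).
  by apply/eqP; rewrite -subr_eq0 -oppr_eq0 -E; apply/eqP; ring.
have D n' := one_subQX_neq0 n'.
have Pn : Q ^+ (2 * n) != 0 by rewrite expf_neq0.
have D2 := D 1%N.
have e1' : Q + e n = Q / ((1 - Q ^+ 2) * Q ^+ (2 * n)) * (1 - Q ^+ (2 * n.+1)).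
  by rewrite /e mulnS exprD; field; rewrite ?Pn ?D2 ?expf_neq0 ?Q0.
have e2' : Q * (1 + Q ^+ 2) + e n =
    Q / ((1 - Q ^+ 2) * Q ^+ (2 * n)) * (1 - Q ^+ (2 * n.+2)).
  by rewrite /e !mulnS !exprD; field; rewrite ?Pn ?D2 ?expf_neq0 ?Q0.
move: E; rewrite e1' e2' -!mulrA => /mulfI/mulfI; rewrite IH; apply=> //.
by rewrite invr_eq0 mulf_neq0.
Qed.

End Haar.

(** * The trace formula and the bound on matrix entries *)

Section Trace.
Variables (R : realType) (q : R).
Hypothesis q01 : 0 < q < 1.
Let q0 : 0 < q. Proof. by case/andP: q01. Qed.
Let q1 : q < 1. Proof. by case/andP: q01. Qed.
Local Notation C := R[i].
Local Notation Q := (q%:C).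
Local Notation SU := (suq2 q).
Local Notation CP := (@CP R q).
Local Notation Lset := (@Lset R q).
Local Notation qa := (qa q : SU).
Local Notation qc := (qc q : SU).
Local Notation B0 := (qc * star qc).
Local Notation Bm := (qa * star qc).
Local Notation Bp := (qc * star qa).
Variables (A : cstarAlgType R) (a c : A).
Hypothesis rel : suq2_rel q a c.
Variable h : A -> C.
Hypothesis haar : haar_state q a c h.
Local Notation iota := (@iota_suq2 R q A a c).
Local Notation hi x := (h (iota x)).

(** A partial sum of the trace formula for the Haar state. *)
Definition trace K (F : SU) : C :=
  (1 - Q ^+ 2) * \sum_(k < K) Q ^+ (2 * k) * entry F k k.

Lemma act_B0X n v i : act (B0 ^+ n) v i = Q ^+ (2 * i * n) * v i.
Proof.
elim: n => [|n IH]; first by rewrite expr0 act1 // muln0 expr0 mul1r.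
rewrite exprS !actM // !act_gen // IH !mulrA -!exprD; congr (Q ^+ _ * _); lia.
Qed.

Lemma act_BmX m : exists g : nat -> C, forall v i,
  act (Bm ^+ m) v i = g i * v (i + m)%N.
Proof.
elim: m => [|m [g IH]].
  by exists (fun=> 1) => v i; rewrite expr0 act1 // mul1r addn0.
exists (fun i => weight q i.+1 * Q ^+ i.+1 * g i.+1) => v i.
by rewrite exprS !actM // !act_gen // IH !mulrA addSnnS.
Qed.

Lemma star_exp (x : SU) m : star (x ^+ m) = star x ^+ m.
Proof.
elim: m => [|m IH]; last by rewrite exprS starM IH -exprSr.
by rewrite !expr0 -[1]/(cls q (WCst 1)) star_cls /= rmorph1.
Qed.

Lemma entry_offdiag n m k :
  entry (B0 ^+ n * Bm ^+ m.+1) k k = 0 /\ entry (B0 ^+ n * Bp ^+ m.+1) k k = 0.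
Proof.
have [g gE] := act_BmX m.+1.
have z : entry (Bm ^+ m.+1) k k = 0.
  by rewrite /entry gE /basis -[X in _ == X]addn0 eqn_add2l mulr0.
split; rewrite /entry actM // act_B0X -/(entry _ k k).
  by rewrite z mulr0.
rewrite -[Bp]starK starM starK -star_exp entry_star // z.
by rewrite rmorph0 mulr0.
Qed.

Lemma Q_gt0 : 0 < Q. Proof. by rewrite ltcR. Qed.
Lemma Q_lt1 : Q < 1. Proof. by rewrite -(rmorph1 (real_complex R)) ltcR. Qed.
Lemma QX_ge0 n : 0 <= Q ^+ n. Proof. by rewrite exprn_ge0 // ltW // Q_gt0. Qed.

Lemma traceZ K l x : trace K (l *: x) = l * trace K x.
Proof.
rewrite /trace mulrCA [l * _]mulr_sumr; congr (_ * _).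
by apply: eq_bigr => k _; rewrite (entryZ q01) mulrCA.
Qed.

Lemma traceD K x y : trace K (x + y) = trace K x + trace K y.
Proof.
rewrite /trace -mulrDr -big_split; congr (_ * _).
by apply: eq_bigr => k _; rewrite (entryD q01) mulrDr.
Qed.

Lemma trace_B0X n K :
  hi (B0 ^+ n) - trace K (B0 ^+ n) = hi (B0 ^+ n) * Q ^+ (2 * n.+1 * K).
Proof.
have D0 : 1 - Q ^+ (2 * n.+1) != 0 by rewrite mulnS one_subQX_neq0.
apply: (mulfI D0); rewrite mulrBr [in RHS]mulrA haar_moment //.
have -> : trace K (B0 ^+ n) = (1 - Q ^+ 2) * \sum_(k < K) (Q ^+ (2 * n.+1)) ^+ k.
  congr (_ * _); apply: eq_bigr => k _; rewrite /entry act_B0X /basis eqxx mulr1.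
  by rewrite -exprD -exprM; congr (Q ^+ _); lia.
have S : (1 - Q ^+ (2 * n.+1)) * \sum_(k < K) (Q ^+ (2 * n.+1)) ^+ k =
    1 - Q ^+ (2 * n.+1 * K).
  by rewrite -[X in X * _]opprB mulNr -subrX1 opprB -exprM.
by rewrite mulrCA S mulrBr mulr1 opprB addrC subrK.
Qed.

(** On CP the Haar state is the trace against (1 - q^2) q^(2k). Stating it as a
    geometric rate for the partial sums makes it stable under linear
    combinations, and reduces it to the monomials of CP_span. *)
Lemma trace_approx F : CP F -> exists2 M : C, 0 <= M &
  forall K, `|hi F - trace K F| <= M * Q ^+ (2 * K).
Proof.
have moment n : exists2 M : C, 0 <= M &
    forall K, `|hi (B0 ^+ n) - trace K (B0 ^+ n)| <= M * Q ^+ (2 * K).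
  exists `|hi (B0 ^+ n)| => // K.
  rewrite trace_B0X normrM ler_wpM2l // ger0_norm ?QX_ge0 //.
  by apply: ler_wiXn2l; rewrite ?ltW ?Q_gt0 ?Q_lt1 //; lia.
have offdiag x : hi x = 0 -> (forall k, entry x k k = 0) -> exists2 M : C, 0 <= M &
    forall K, `|hi x - trace K x| <= M * Q ^+ (2 * K).
  move=> hx ex; exists 0 => // K; rewrite mul0r hx /trace big1 ?mulr0 ?subrr ?normr0 //.
  by move=> k _; rewrite ex mulr0.
move: F; apply: (CP_span q0).
- move=> x y [M M0 HM] [M' M'0 HM']; exists (M + M'); first exact: addr_ge0.
  move=> K; rewrite mulrDl; apply: le_trans (lerD (HM K) (HM' K)).
  by rewrite traceD iotaD // (hD haar) opprD addrACA ler_normD.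
- move=> l x [M M0 HM]; exists (`|l| * M); first exact: mulr_ge0.
  move=> K; rewrite -mulrA; apply: le_trans (ler_wpM2l (normr_ge0 l) (HM K)).
  by rewrite -normrM mulrBr iotaZ // (hZ haar) traceZ.
- move=> n [|m]; first by rewrite expr0 mulr1.
  by apply: offdiag => [|k]; [exact: (haar_offdiag q01 rel haar n m).1
    |exact: (entry_offdiag n m k).1].
- move=> n [|m]; first by rewrite expr0 mulr1.
  by apply: offdiag => [|k]; [exact: (haar_offdiag q01 rel haar n m).2
    |exact: (entry_offdiag n m k).2].
Qed.

(** The entry (k, k) of star f f is the squared norm of column k of f. *)
Lemma entry_star_mul (f : SU) i k :
  0 <= entry (star f * f) k k /\ `|entry f i k| ^+ 2 <= entry (star f * f) k k.
Proof.
have [K0 HK] := entryM q01 (star f) f k.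
have E K : (K0 <= K)%N -> entry (star f * f) k k =
    \sum_(l < K) `|entry f l k| ^+ 2.
  move=> KK; rewrite (HK K KK); apply: eq_bigr => l _.
  by rewrite entry_star // normCK mulrC.
split; first by rewrite (E K0) // sumr_ge0 // => l _; rewrite exprn_ge0.
rewrite (E (maxn K0 i.+1)) ?leq_maxl //.
rewrite (bigD1 (Ordinal (leq_maxr K0 i.+1))) //= lerDl sumr_ge0 // => l _.
by rewrite exprn_ge0.
Qed.

Lemma hi_star_ge0 (f : SU) : 0 <= hi (star f * f).
Proof. by rewrite iotaM // iota_star //; apply: h_ge0 haar _. Qed.

Lemma le_of_geometric (x y M : C) : 0 <= x -> 0 <= y -> 0 <= M ->
  (exists K0, forall K, (K0 <= K)%N -> x <= y + M * Q ^+ (2 * K)) -> x <= y.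
Proof.
have toR (z : C) : 0 <= z -> z = (complex.Re z)%:C.
  by case: z => u v; rewrite lecE /= => /andP [/eqP -> _].
move=> /toR -> /toR -> /toR ->; move: (complex.Re x) (complex.Re y) (complex.Re M).
move=> {}x {}y {}M [K0 H]; rewrite lecR.
have {}H K : (K0 <= K)%N -> x <= y + M * (q ^+ 2) ^+ K.
  by move=> /H; rewrite -rmorphXn -rmorphM -rmorphD lecR exprM.
have cv : (fun K => y + M * (q ^+ 2) ^+ K) @ \oo --> (y : R).
  rewrite -[X in _ --> X]addr0 -[X in _ + X](mulr0 M).
  apply: cvgD; first exact: cvg_cst.
  apply: cvgM; first exact: cvg_cst.
  by apply: cvg_expr; rewrite ger0_norm ?exprn_ge0 ?exprn_ilt1 // ltW.
apply: (cvgr_to_ge cv); exists K0 => // K /=; exact: H.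
Qed.

(** One diagonal entry of a positive matrix is bounded by its weighted trace, and
    one entry of a column by the norm of the column. *)
Lemma haar_entry_bound f i j : CP f ->
  (1 - Q ^+ 2) * Q ^+ (2 * j) * `|entry f i j| ^+ 2 <= hi (star f * f).
Proof.
move=> Cf; have Cff : CP (star f * f) by apply: CPM => //; apply: CP_star.
have D0 : 0 <= 1 - Q ^+ 2.
  by rewrite subr_ge0 exprn_ile1 ?ltW ?Q_gt0 ?Q_lt1.
have [M M0 HM] := trace_approx Cff.
have h0' := hi_star_ge0 f.
apply: (@le_of_geometric _ _ M) => //.
  by rewrite !mulr_ge0 ?QX_ge0 ?exprn_ge0.
exists j.+1 => K jK.
have T : (1 - Q ^+ 2) * Q ^+ (2 * j) * `|entry f i j| ^+ 2 <= trace K (star f * f).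
  rewrite -mulrA ler_wpM2l // (bigD1 (Ordinal jK)) //=.
  rewrite -[X in X <= _]addr0 lerD //.
    by rewrite ler_wpM2l ?QX_ge0 // (entry_star_mul f i j).2.
  by rewrite sumr_ge0 // => k _; rewrite mulr_ge0 ?QX_ge0 ?(entry_star_mul f i k).1.
apply: le_trans T _; rewrite -lerBlDl.
have := HM K; rewrite distrC; apply: le_trans.
apply: real_ler_norm.
have T0 : 0 <= trace K (star f * f).
  rewrite mulr_ge0 // sumr_ge0 // => k _.
  by rewrite mulr_ge0 ?QX_ge0 ?(entry_star_mul f i k).1.
by rewrite rpredB ?ger0_real.
Qed.

End Trace.

(** * Null sequences and the norm of a C-star algebra *)

Lemma normcE (R : realType) (z : R[i]) : `|z| = (Normc.normc z)%:C.
Proof. by []. Qed.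

Section Null.
Variable R : realType.
Local Notation C := R[i].

Definition null (x : nat -> C) :=
  forall e : C, 0 < e -> exists N, forall n, (N <= n)%N -> `|x n| < e.

Lemma null_le x y : (forall n, `|x n| <= `|y n|) -> null y -> null x.
Proof.
by move=> xy ny e /ny [N HN]; exists N => n /HN; apply: le_lt_trans.
Qed.

Lemma null_eq x y : (forall n, x n = y n) -> null x -> null y.
Proof. by move=> /funext ->. Qed.

Lemma nullD x y : null x -> null y -> null (fun n => x n + y n).
Proof.
move=> nx ny e e0; have e2 : 0 < e / 2 by rewrite divr_gt0.
have [N HN] := nx _ e2; have [M HM] := ny _ e2.
exists (maxn N M) => n; rewrite geq_max => /andP [/HN xn /HM yn].
by rewrite (le_lt_trans (ler_normD _ _)) // [ltRHS]splitr ltrD.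
Qed.

Lemma nullM l x : null x -> null (fun n => l * x n).
Proof.
move=> nx e e0; have l1 : 0 < `|l| + 1 by rewrite ltr_wpDl.
have [N HN] := nx _ (divr_gt0 e0 l1); exists N => n /HN xn.
apply: (@le_lt_trans _ _ ((`|l| + 1) * `|x n|)).
  by rewrite normrM ler_wpM2r // lerDl.
by rewrite mulrC -ltr_pdivlMr.
Qed.

Lemma nullB x y : null x -> null y -> null (fun n => x n - y n).
Proof.
move=> nx /(nullM (-1)) ny; apply: null_eq (nullD nx ny) => n.
by rewrite mulN1r.
Qed.

Lemma null0 : null (fun=> 0).
Proof. by move=> e e0; exists 0%N => n _; rewrite normr0. Qed.

Lemma null_sum (I : Type) (s : seq I) (x : I -> nat -> C) :
  (forall i, null (x i)) -> null (fun n => \sum_(i <- s) x i n).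
Proof.
move=> nx; elim: s => [|i s IH]; first by under eq_fun do rewrite big_nil; apply: null0.
by under eq_fun do rewrite big_cons; apply: nullD.
Qed.

Lemma null_cancel l x : l != 0 -> null (fun n => l * x n) -> null x.
Proof. by move=> l0 /(nullM l^-1); apply: null_eq => n; rewrite mulKf. Qed.

Definition harmC n : C := (n.+1%:R^-1 : R)%:C.

Lemma harmC_gt0 n : 0 < harmC n.
Proof. by rewrite /harmC ltcR invr_gt0. Qed.

Lemma null_harmC : null harmC.
Proof.
move=> e e0.
have -> : e = (complex.Re e)%:C.
  by move: e0; case: e => u v; rewrite ltcE /= => /andP [/eqP -> _].
have e0' : 0 < complex.Re e by move: e0; rewrite ltcE => /andP [].
have /cvgr0Pnorm_lt /(_ _ e0') [N _ HN] := @cvg_harmonic R.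
exists N => n nN; rewrite ger0_norm ?(ltW (harmC_gt0 n)) // /harmC ltcR.
by have := HN n nN; rewrite /= ger0_norm // invr_ge0.
Qed.

End Null.

Section Cnorm.
Variables (R : realType) (A : cstarAlgType R).
Implicit Types x y : A.

Lemma cnormN x : cnorm (- x) = cnorm x.
Proof. by rewrite -scaleN1r cnormZ normcN Normc.normc1 mul1r. Qed.
Lemma cnorm0 : cnorm (0 : A) = 0.
Proof. by rewrite -(scale0r 0) cnormZ Normc.normc0 mul0r. Qed.
Lemma cnormB x y : cnorm (x - y) <= cnorm x + cnorm y.
Proof. by rewrite -(cnormN y); apply: cnormD. Qed.
Lemma cnorm_ge0 x : 0 <= cnorm x.
Proof. by have := cnormB x x; rewrite subrr cnorm0 -mulr2n pmulrn_lge0. Qed.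
Lemma cnorm_sub x y : cnorm (x - y) = cnorm (y - x).
Proof. by rewrite -cnormN opprB. Qed.

Lemma cnorm_star_le x : cnorm (star x) <= cnorm x.
Proof.
suff H y : cnorm y <= cnorm (star y) by have := H (star x); rewrite starK.
have [->|y0] := eqVneq (cnorm y) 0; first exact: cnorm_ge0.
have y1 : 0 < cnorm y by rewrite lt_neqAle eq_sym y0 cnorm_ge0.
by rewrite -(ler_pM2r y1) -expr2 -cnorm_star cnormM.
Qed.

(** Polynomial approximation in C(CP^1_q) comes from the minimality of CCP among
    closed subalgebras. *)
Lemma closure_star_subalg (S : set A) : star_subalg S ->
  let cl := [set x | forall e, 0 < e -> exists2 y, S y & cnorm (x - y) < e] in
  star_subalg cl /\ cnorm_closed cl.
Proof.
move=> [S1 SD SZ SM Sstar] cl; split; first split.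
- by move=> e e0; exists 1; rewrite // subrr cnorm0.
- move=> x y Hx Hy e e0; have e2 : 0 < e / 2 by rewrite divr_gt0.
  have [x' Sx xx] := Hx _ e2; have [y' Sy yy] := Hy _ e2.
  exists (x' + y'); first exact: SD.
  rewrite opprD addrACA (le_lt_trans (cnormD _ _)) //.
  by rewrite [ltRHS]splitr ltrD.
- move=> l x Hx e e0; have l1 : 0 < Normc.normc l + 1.
    by rewrite ltr_wpDl // -lecR -normcE normr_ge0.
  have [x' Sx xx] := Hx (e / (Normc.normc l + 1)) (divr_gt0 e0 l1).
  exists (l *: x'); first exact: SZ.
  rewrite -scalerBr cnormZ; apply: (@le_lt_trans _ _ ((Normc.normc l + 1) * cnorm (x - x'))).
    by rewrite ler_wpM2r ?cnorm_ge0 // lerDl.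
  by rewrite mulrC -ltr_pdivlMr.
- move=> x y Hx Hy e e0.
  have y1 : 0 < cnorm y + 1 by rewrite ltr_wpDl ?cnorm_ge0.
  have [x' Sx xx] := Hx (e / 2 / (cnorm y + 1)) (divr_gt0 (divr_gt0 e0 (ltr0Sn _ 1)) y1).
  have x1 : 0 < cnorm x' + 1 by rewrite ltr_wpDl ?cnorm_ge0.
  have [y' Sy yy] := Hy (e / 2 / (cnorm x' + 1)) (divr_gt0 (divr_gt0 e0 (ltr0Sn _ 1)) x1).
  exists (x' * y'); first exact: SM.
  have -> : x * y - x' * y' = (x - x') * y + x' * (y - y').
    by rewrite mulrBl mulrBr addrA subrK.
  rewrite (le_lt_trans (cnormD _ _)) // [ltRHS]splitr ltrD //.
    apply: (@le_lt_trans _ _ (cnorm (x - x') * (cnorm y + 1))).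
      by rewrite (le_trans (cnormM _ _)) // ler_wpM2l ?cnorm_ge0 // lerDl.
    by rewrite -ltr_pdivlMr.
  apply: (@le_lt_trans _ _ ((cnorm x' + 1) * cnorm (y - y'))).
    by rewrite (le_trans (cnormM _ _)) // ler_wpM2r ?cnorm_ge0 // lerDl.
  by rewrite mulrC -ltr_pdivlMr.
- move=> x Hx e e0; have [x' Sx xx] := Hx _ e0.
  exists (star x'); first exact: Sstar.
  have starN y : star (- y) = - star y.
    by rewrite -scaleN1r starZ rmorphN1 scaleN1r.
  by rewrite -starN -starD (le_lt_trans (cnorm_star_le _)).
- move=> x Hx e e0; have e2 : 0 < e / 2 by rewrite divr_gt0.
  have [y Hy xy] := Hx _ e2; have [z Sz yz] := Hy _ e2.
  exists z => //; rewrite -(subrK y x) -addrA (le_lt_trans (cnormD _ _)) //.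
  by rewrite [ltRHS]splitr ltrD.
Qed.

End Cnorm.

(** * Matrix entries are continuous in the L2 norm *)

Section Continuity.
Variables (R : realType) (q : R).
Hypothesis q01 : 0 < q < 1.
Let q0 : 0 < q. Proof. by case/andP: q01. Qed.
Let q1 : q < 1. Proof. by case/andP: q01. Qed.
Local Notation C := R[i].
Local Notation Q := (q%:C).
Local Notation SU := (suq2 q).
Local Notation CP := (@CP R q).
Local Notation Lset := (@Lset R q).
Local Notation qa := (qa q : SU).
Local Notation qc := (qc q : SU).
Variables (A : cstarAlgType R) (a c : A).
Hypothesis rel : suq2_rel q a c.
Variable h : A -> C.
Hypothesis haar : haar_state q a c h.
Variables (H : completeNormedModType C) (ip : H -> H -> C) (Lam : A -> H).
Hypothesis L2 : gns h ip Lam.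
Local Notation iota := (@iota_suq2 R q A a c).

Lemma QX_le1 n : Q ^+ n <= 1.
Proof. by apply: exprn_ile1; apply: ltW; rewrite ?Q_gt0 ?Q_lt1. Qed.

Lemma CCP_approx g : CCP a c g ->
  forall e : R, 0 < e -> exists2 f, CP f & cnorm (g - iota f) < e.
Proof.
pose S : set A := [set x | exists2 f, CP f & x = iota f].
have SS : star_subalg S.
  split.
  - by exists 1; [exact: CP1|rewrite iota1].
  - move=> _ _ [f Cf ->] [f' Cf' ->]; exists (f + f'); [exact: CPD|by rewrite iotaD].
  - move=> l _ [f Cf ->]; exists (l *: f); [exact: CPZ|by rewrite iotaZ].
  - move=> _ _ [f Cf ->] [f' Cf' ->]; exists (f * f'); [exact: CPM|by rewrite iotaM].
  - move=> _ [f Cf ->]; exists (star f); [exact: CP_star|by rewrite iota_star].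
have [ia ic] : iota qa = a /\ iota qc = c by have [] := iota_suq2P rel.
have sub : CCP a c `<=`
    [set x | forall e, 0 < e -> exists2 y, S y & cnorm (x - y) < e].
  apply: smallest_sub; first exact: closure_star_subalg.
  move=> x gx e e0; exists x; last by rewrite subrr cnorm0.
  have [ha hc] : holo qa /\ holo qc by split; [left|right].
  have [ha' hc'] : aholo (star qa) /\ aholo (star qc) by split; [left|right].
  case: gx => [[]|] ->.
  - by exists (qa * star qc); [apply: CP_holo_aholo|rewrite iotaM // iota_star // ia ic].
  - by exists (qc * star qa); [apply: CP_holo_aholo|rewrite iotaM // iota_star // ia ic].
  - by exists (qc * star qc); [apply: CP_holo_aholo|rewrite iotaM // iota_star // ic].
by move=> /sub Hg e /Hg [_ [f Cf ->]]; exists f.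
Qed.

Lemma LamB x y : Lam (x - y) = Lam x - Lam y.
Proof.
have [_ l _ _] := L2.
by rewrite [x - y]addrC -scaleN1r l scaleN1r addrC.
Qed.

Lemma Lam_norm x : `|Lam x| ^+ 2 = h (star x * x).
Proof. by have [[_ _ <-] _ -> _] := L2. Qed.

Lemma ler_Lam x y : h (star x * x) <= h (star y * y) -> `|Lam x| <= `|Lam y|.
Proof.
rewrite -!Lam_norm => xy; rewrite -(ler_pXn2r (n := 2)) ?nnegrE ?normr_ge0 //.
Qed.

Lemma Lam_le_cnorm x : `|Lam x| <= (cnorm x)%:C.
Proof.
rewrite -(ler_pXn2r (n := 2)) ?nnegrE ?normr_ge0 ?lecR ?cnorm_ge0 //.
rewrite Lam_norm -rmorphXn -cnorm_star.
have := h_bound haar (star x * x); rewrite -lecR.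
by rewrite -normcE ger0_norm // (h_ge0 haar).
Qed.

(** The square root of haar_entry_bound; the constant is replaced by its square,
    which is smaller. *)
Lemma entry_L2_CP f i j : CP f ->
  (1 - Q ^+ 2) * Q ^+ (2 * j) * `|entry f i j| <= `|Lam (iota f)|.
Proof.
move=> Cf; set d := (1 - Q ^+ 2) * _.
have D0 : 0 <= 1 - Q ^+ 2 <= 1.
  apply/andP; split; last by rewrite gerBl QX_ge0.
  by rewrite subr_ge0 QX_le1.
have d01 : 0 <= d <= 1.
  case/andP: D0 => D0 D1; apply/andP; split; rewrite /d; first by rewrite mulr_ge0 ?QX_ge0.
  by rewrite mulr_ile1 ?QX_ge0 ?QX_le1.
case/andP: d01 => d0 d1.
have dE : 0 <= d * `|entry f i j| by apply: mulr_ge0.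
rewrite -(ler_pXn2r (n := 2)) ?nnegrE ?normr_ge0 //.
rewrite Lam_norm -iota_star // -iotaM //.
apply: le_trans (haar_entry_bound q01 rel haar i j Cf).
rewrite exprMn; apply: ler_wpM2r; first by rewrite exprn_ge0 ?normr_ge0.
by rewrite expr2 ler_piMr.
Qed.

(** The difference of the squared norms is the squared norm of a y. *)
Lemma Lam_star_c y : `|Lam (star c * y)| <= `|Lam y|.
Proof.
have [r1 r2 r3 r4 r5] := rel.
apply: ler_Lam; rewrite -subr_ge0 -(hB haar) starM starK.
rewrite (_ : _ - _ = star (a * y) * (a * y)) ?(h_ge0 haar) //.
by rewrite starM !mulrA -mulrBl -[X in X - _]mulr1 -r4 -!mulrA -r3 -mulrBr addrK !mulrA.
Qed.

(** Multiplying a form twice by star c on the left lands in CP, does not increase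
    the L2 norm, and only multiplies row i by the positive number q^(2i). *)
Lemma entry_L2_form y i j : Lset (-2) y ->
  (1 - Q ^+ 2) * Q ^+ (2 * j) * Q ^+ (2 * i) * `|entry y i j| <= `|Lam (iota y)|.
Proof.
move=> Ly; have hc' : aholo (star qc) by right.
have Cy : CP (star qc * (star qc * y)).
  by apply: Lset0; apply: (@Lset_aholo R q q0 (-1)) => //;
    apply: (@Lset_aholo R q q0 (-2)).
have [_ _ _ _ ic] := iota_suq2P rel.
apply: le_trans (Lam_star_c (iota y)).
apply: le_trans (Lam_star_c _).
have := entry_L2_CP i j Cy; rewrite !iotaM // iota_star // ic; apply: le_trans.
rewrite -[leLHS]mulrA /entry !actM // !act_gen // -/(entry y i j).
have -> : Q ^+ i * (Q ^+ i * entry y i j) = Q ^+ (2 * i) * entry y i j.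
  by rewrite mulrA -exprD addnn mul2n.
by rewrite normrM [`|Q ^+ _|]ger0_norm ?QX_ge0.
Qed.

Lemma null_entry_of_bound (u : nat -> SU) (d : C) i j : 0 < d ->
  (forall n, d * `|entry (u n) i j| <= `|Lam (iota (u n))|) ->
  null (fun n => `|Lam (iota (u n))|) -> null (fun n => entry (u n) i j).
Proof.
move=> d0 ub nu; apply: (null_cancel (l := d)); first by rewrite gt_eqF.
apply: null_le nu => n; rewrite normrM normr_id gtr0_norm //.
Qed.

Lemma L2_weight_gt0 j : 0 < (1 - Q ^+ 2) * Q ^+ (2 * j).
Proof.
by rewrite mulr_gt0 ?subr_gt0 ?exprn_gt0 ?exprn_ilt1 ?ltW ?Q_gt0 ?Q_lt1.
Qed.

Lemma null_entry_CP (u : nat -> SU) i j : (forall n, CP (u n)) ->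
  null (fun n => `|Lam (iota (u n))|) -> null (fun n => entry (u n) i j).
Proof.
move=> Cu; apply: null_entry_of_bound (L2_weight_gt0 j) _ => n.
exact: entry_L2_CP.
Qed.

Lemma null_entry_form (u : nat -> SU) i j : (forall n, Lset (-2) (u n)) ->
  null (fun n => `|Lam (iota (u n))|) -> null (fun n => entry (u n) i j).
Proof.
move=> Lu; apply: (@null_entry_of_bound _ ((1 - Q ^+ 2) * Q ^+ (2 * j) * Q ^+ (2 * i))).
  by rewrite mulr_gt0 ?L2_weight_gt0 ?exprn_gt0 ?Q_gt0.
by move=> n; apply: entry_L2_form.
Qed.

End Continuity.

(** * Almost intertwiners of two weighted shifts *)

Section Recursion.
Variable R : realType.
Local Notation C := R[i].
Variables (t1 t2 : nat -> C) (k1 k2 : nat) (u : nat -> nat -> nat -> C).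
Hypothesis t1_neq0 : forall i, i != k1 -> t1 i != 0.
Hypothesis t2_neq0 : forall i, i != k2 -> t2 i != 0.
Hypothesis t1_eq0 : t1 k1 = 0.
Hypothesis t2_eq0 : t2 k2 = 0.
Hypothesis column0 : forall i, null (fun n => t1 i * u i.+1 0 n).
Hypothesis diagonal : forall i j,
  null (fun n => t2 j * u i j n - t1 i * u i.+1 j.+1 n).

Lemma null_down i j : i != k1 -> null (u i j) -> null (u i.+1 j.+1).
Proof.
move=> ik /(nullM (t2 j)) nu; apply: (null_cancel (t1_neq0 ik)).
by apply: null_eq (nullB nu (diagonal i j)) => n; rewrite subKr.
Qed.

Lemma null_up i j : j != k2 -> null (u i.+1 j.+1) -> null (u i j).
Proof.
move=> jk /(nullM (t1 i)) nu; apply: (null_cancel (t2_neq0 jk)).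
by apply: null_eq (nullD (diagonal i j) nu) => n; rewrite subrK.
Qed.

(** Row k1 can only survive in column k2, where the diagonal through it starts in
    column 0 with a null entry. *)
Lemma null_row : (k2 < k1)%N -> forall j, null (u k1 j).
Proof.
move=> k21 j; have [->{j}|jk] := eqVneq j k2; last first.
  apply: (null_cancel (t2_neq0 jk)); apply: null_eq (diagonal k1 j) => n.
  by rewrite t1_eq0 mul0r subr0.
suff H m : (m <= k2)%N -> null (u (k1 - k2 + m) m).
  by have := H k2 (leqnn _); rewrite subnK // ltnW.
elim: m => [_|m IH mk].
  rewrite addn0 -(prednK (n := k1 - k2)) ?subn_gt0 //.
  apply: (null_cancel (l := t1 (k1 - k2).-1)) (column0 _).
  by apply: t1_neq0; lia.
by rewrite addnS; apply: null_down (IH (ltnW mk)); lia.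
Qed.

(** The diagonal through (0, d) reaches row k1, where the weight t1 vanishes; going
    back up it meets only nonzero weights t2. *)
Lemma null_top d : (forall m, (m <= k1)%N -> d + m != k2)%N -> null (u 0 d).
Proof.
move=> dk; suff H m : (m <= k1)%N -> null (u (k1 - m) (d + (k1 - m))).
  by have := H k1 (leqnn _); rewrite subnn addn0.
elim: m => [_|m IH mk].
  rewrite subn0; apply: (null_cancel (t2_neq0 (dk _ (leqnn _)))).
  by apply: null_eq (diagonal k1 (d + k1)) => n; rewrite t1_eq0 mul0r subr0.
apply: null_up; first by apply: dk; rewrite leq_subr.
by rewrite -addnS -subSn // subSS; apply: IH; apply: ltnW.
Qed.

(** Columns 0 and k2 + 1 are those that the second shift annihilates, so the first
    shift annihilates their images; null_top removes the entry in row 0. *)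
Lemma null_columns : (k1 < k2)%N -> forall i, i != k1.+1 ->
  null (u i 0) /\ null (u i k2.+1).
Proof.
move=> k12 [|i] ik; first by split; apply: null_top => m mk; lia.
have ik' : i != k1 by [].
split; first exact: (null_cancel (t1_neq0 ik') (column0 i)).
apply: (null_cancel (t1_neq0 ik')).
have := nullM (-1) (diagonal i k2); apply: null_eq => n.
by rewrite t2_eq0 mul0r sub0r mulN1r opprK.
Qed.
End Recursion.

(** * From a gauge transformation to an almost intertwiner *)

Section Gauge.
Variables (R : realType) (q : R).
Hypothesis q01 : 0 < q < 1.
Let q0 : 0 < q. Proof. by case/andP: q01. Qed.
Let q1 : q < 1. Proof. by case/andP: q01. Qed.
Local Notation C := R[i].
Local Notation Q := (q%:C).
Local Notation SU := (suq2 q).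
Local Notation CP := (@CP R q).
Local Notation Lset := (@Lset R q).
Variables (A : cstarAlgType R) (a c : A).
Hypothesis rel : suq2_rel q a c.
Variable h : A -> C.
Hypothesis haar : haar_state q a c h.
Variables (H : completeNormedModType C) (ip : H -> H -> C) (Lam : A -> H).
Hypothesis L2 : gns h ip Lam.
Local Notation iota := (@iota_suq2 R q A a c).

Definition shift_form (x : SU) (s : nat -> C) :=
  forall v i, act x v i = s i * v i.+1.

Definition coord_weight i : C := kappa q * weight q i.+1 * Q ^- i.

Lemma act_basis (x : SU) l j i :
  act x (fun k => l * basis R j k) i = l * entry x i j.
Proof.
have := act_linear x l (basis R j) (fun=> 0) i.
rewrite [act x (fun=> 0) i]wact0 addr0 => <-; congr (act x _ i).
by apply/funext => k; rewrite addr0.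
Qed.

Lemma shift_basis (s : nat -> C) j k :
  s k * basis R j.+1 k.+1 = s j * basis R j k.
Proof. by rewrite /basis eqSS; case: eqVneq => [->|]; rewrite ?mulr0. Qed.

(** The rate is an arbitrary choice of null sequence. *)
Definition approx (g : A) (p : nat -> SU) :=
  (forall n, CP (p n)) /\ forall n, (cnorm (g - iota (p n)))%:C <= harmC R n.

Lemma approx_exists g : CCP a c g -> exists p, approx g p.
Proof.
move=> Cg; have P n : exists f, CP f /\ cnorm (g - iota f) < n.+1%:R^-1.
  have r0 : 0 < (n.+1%:R^-1 : R) by rewrite invr_gt0.
  by have [f Cf fg] := CCP_approx q01 rel Cg r0; exists f.
have [p pP] := choice P; exists p; split=> n; first by have [] := pP n.
by rewrite /harmC lecR ltW //; have [] := pP n.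
Qed.

Lemma null_harmM (K : C) (x : nat -> C) : 0 <= K ->
  (forall n, `|x n| <= K * harmC R n) -> null x.
Proof.
move=> K0 xK; apply: null_le (nullM K (@null_harmC R)) => n.
by rewrite (ger0_norm (mulr_ge0 K0 (ltW (harmC_gt0 R n)))).
Qed.

Section GraphRecursion.
Variables (g : A) (theta1 theta2 : Omega q) (p : nat -> SU).
Hypothesis gp : approx g p.
Hypothesis graph : dbar_graph q a c Lam
  (Lam g, Lam (g * iota (Lval theta2) - iota (Lval theta1) * g)).

(** A point of the closed graph is a limit of polynomials f n with their dbar,
    but only in L2; the p n approximate g in norm. The two families have the same
    entries in the limit. *)
Lemma graph_approx : exists f : nat -> SU, (forall n, CP (f n)) /\
  (forall i j, null (fun n => entry (f n - p n) i j)) /\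
  forall i j, null (fun n =>
    entry (delta (f n) - (p n * Lval theta2 - Lval theta1 * p n)) i j).
Proof.
set eta := Lam (g * iota (Lval theta2) - iota (Lval theta1) * g).
have P n : exists f, CP f /\ `|Lam g - Lam (iota f)| <= harmC R n /\
    `|eta - Lam (iota (delta f))| <= harmC R n.
  have [] := graph (nbhsx_ballx (Lam g, eta) (harmC R n) (harmC_gt0 R n)).
  move=> _ [[f ->] []] /=; rewrite -!ball_normE /= => B1 B2.
  exists (CPval f); split; first exact: CPvalP.
  by rewrite dbarE // in B2; split; apply: ltW.
have [f fP] := choice P; have [Cp pg] := gp.
have Cf n : CP (f n) by have [] := fP n.
have hp n : `|Lam g - Lam (iota (p n))| <= harmC R n.
  by rewrite -(LamB L2); apply: le_trans (Lam_le_cnorm haar L2 _) (pg n).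
exists f; split=> //; split=> i j.
- apply: (null_entry_CP q01 rel haar L2); first by move=> n; apply: CPB.
  apply: (@null_harmM 2%:R) => // n; rewrite normr_id iotaB // (LamB L2).
  rewrite -(subrKA (Lam g)) (le_trans (ler_normD _ _)) // mulr_natl mulr2n.
  by rewrite lerD // distrC; have [_ []] := fP n.
- apply: (null_entry_form q01 rel haar L2).
    have L0 : Lset 0 `<=` CP by apply: Lset0.
    move=> n; rewrite -scaleN1r; apply: LsetD.
      rewrite -[-2]add0r; apply: delta_Lset => //; exact: CP_Lset0.
    apply: Lset_scale; rewrite -scaleN1r; apply: LsetD.
      by apply: Lset_lmul => //; apply: Lval_Lset.
    by apply: Lset_scale; apply: Lset_rmul => //; apply: Lval_Lset.
  set K : R := 1 + (cnorm (iota (Lval theta2)) + cnorm (iota (Lval theta1))).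
  have K0 : 0 <= K by rewrite !addr_ge0 ?cnorm_ge0.
  apply: (@null_harmM K%:C); first by rewrite lecR.
  move=> n; rewrite normr_id !iotaB // !iotaM // (LamB L2).
  rewrite -(subrKA eta) (le_trans (ler_normD _ _)) // rmorphD mulrDl mul1r.
  rewrite lerD //; first by rewrite distrC; have [_ []] := fP n.
  rewrite /eta -(LamB L2) (le_trans (Lam_le_cnorm haar L2 _)) //.
  have -> : g * iota (Lval theta2) - iota (Lval theta1) * g -
      (iota (p n) * iota (Lval theta2) - iota (Lval theta1) * iota (p n)) =
      (g - iota (p n)) * iota (Lval theta2) - iota (Lval theta1) * (g - iota (p n)).
    by rewrite mulrBl mulrBr !opprB addrACA [in RHS]addrACA; congr (_ + _); rewrite addrC.
  apply: le_trans (_ : ((cnorm (iota (Lval theta2)) + cnorm (iota (Lval theta1))) *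
      cnorm (g - iota (p n)))%:C <= _).
    rewrite lecR (le_trans (cnormB _ _)) // [leRHS]mulrDl lerD //.
      by rewrite mulrC cnormM.
    exact: cnormM.
  rewrite rmorphM ler_wpM2l //; first by rewrite lecR addr_ge0 ?cnorm_ge0.
  exact: pg.
Qed.

Variables s1 s2 : nat -> C.
Hypothesis form1 : shift_form (Lval theta1) s1.
Hypothesis form2 : shift_form (Lval theta2) s2.
Let t1 i := coord_weight i - s1 i.
Let t2 i := coord_weight i - s2 i.

(** By delta_commutator, dbar g = g theta2 - theta1 g reads
    g (x - theta2) = (x - theta1) g, with both x - theta weighted backward
    shifts; these are its entries, up to null sequences. *)
Lemma graph_recursion :
  (forall i, null (fun n => t1 i * entry (p n) i.+1 0)) /\
  forall i j, null (fun n => t2 j * entry (p n) i j - t1 i * entry (p n) i.+1 j.+1).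
Proof.
have [f [Cf [fp fD]]] := graph_approx.
have e1 (x : SU) i j : entry (Lval theta1 * x) i j = s1 i * entry x i.+1 j.
  by rewrite /entry actM // form1.
split=> [i|i j].
- have := nullM (-1) (nullD (fD i 0%N) (nullM (coord_weight i) (fp i.+1 0%N))).
  apply: null_eq => n; rewrite !(entryB q01) e1.
  have -> : entry (p n * Lval theta2) i 0 = 0.
    rewrite /entry actM // (_ : act (Lval theta2) _ = (fun=> 0)) ?[LHS]wact0 //.
    by apply/funext => k; rewrite form2 /basis mulr0.
  have -> : entry (delta (f n)) i 0 = - (coord_weight i * entry (f n) i.+1 0).
    rewrite {1}/entry (delta_commutator q01 (Cf n)).
    rewrite (_ : coord q (basis R 0) = (fun=> 0)) ?[X in X - _]wact0 ?sub0r //.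
    by apply/funext => k; rewrite /coord /basis mulr0.
  by rewrite /t1; ring.
- have := nullD (nullB (fD i j.+1) (nullM (coord_weight j) (fp i j)))
                (nullM (coord_weight i) (fp i.+1 j.+1)).
  apply: null_eq => n; rewrite !(entryB q01) e1.
  have -> : entry (p n * Lval theta2) i j.+1 = s2 j * entry (p n) i j.
    rewrite /entry actM // -act_basis; congr (act _ _ i).
    by apply/funext => k; rewrite form2 shift_basis.
  have -> : entry (delta (f n)) i j.+1 = coord_weight j * entry (f n) i j
      - coord_weight i * entry (f n) i.+1 j.+1.
    rewrite {1}/entry (delta_commutator q01 (Cf n)) -act_basis; congr (_ - _).
    congr (act _ _ i).
    by apply/funext => k; rewrite /coord (shift_basis coord_weight).
  by rewrite /t1 /t2; ring.
Qed.

End GraphRecursion.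

(** Entries are continuous in norm, so products of approximants of g and of its
    inverse are nearly the identity matrix, uniformly in both indices. *)
Lemma approx_product g g' p p' i j : g * g' = 1 -> approx g p -> approx g' p' ->
  forall e : C, 0 < e -> exists N, forall n m, (N <= n)%N -> (N <= m)%N ->
    `|entry (p n * p' m) i j - (i == j)%:R| < e.
Proof.
move=> gg' [Cp pg] [Cp' pg'] e e0.
pose K : R := cnorm g + cnorm g' + 1.
have K0 : 0 < K by rewrite ltr_wpDl // addr_ge0 ?cnorm_ge0.
have d0 := L2_weight_gt0 q01 j; set d := _ * _ in d0.
have dK : 0 < d / K%:C / 2%:R.
  by rewrite divr_gt0 // divr_gt0 // ltcR.
have [N HN] := @null_harmC R _ (mulr_gt0 dK e0).
exists N => n m Nn Nm.
have {HN} [Hn Hm] : K%:C * harmC R n < d * e / 2%:R /\ K%:C * harmC R m < d * e / 2%:R.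
  have E : d * e / 2%:R = K%:C * (d / K%:C / 2%:R * e).
    by field; rewrite fmorph_eq0 gt_eqF.
  rewrite E; split; rewrite ltr_pM2l ?ltcR //.
    by have := HN n Nn; rewrite ger0_norm // ltW // harmC_gt0.
  by have := HN m Nm; rewrite ger0_norm // ltW // harmC_gt0.
rewrite -(entry1 q01) -(entryB q01) -(ltr_pM2l d0).
have Cpp : CP (p n * p' m - 1) by apply: CPB; [apply: CPM|apply: CP1].
apply: le_lt_trans (entry_L2_CP q01 rel haar L2 i j Cpp) _.
apply: le_lt_trans (Lam_le_cnorm haar L2 _) _.
rewrite iotaB // iotaM // iota1 // -gg'.
have -> : iota (p n) * iota (p' m) - g * g' =
    (iota (p n) - g) * iota (p' m) + g * (iota (p' m) - g').
  by rewrite mulrBl mulrBr addrA subrK.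
apply: (@le_lt_trans _ _ (K%:C * harmC R n + K%:C * harmC R m)); last first.
  by rewrite [ltRHS]splitr ltrD.
rewrite /harmC -!rmorphM -rmorphD lecR (le_trans (cnormD _ _)) //.
have := pg n; have := pg' m; rewrite /harmC !lecR => Hm' Hn'.
have pm : cnorm (iota (p' m)) <= K.
  rewrite -(subrK g' (iota (p' m))) (le_trans (cnormD _ _)) // addrC lerD //.
    by rewrite lerDr cnorm_ge0.
  by rewrite cnorm_sub (le_trans Hm') // invf_le1 ?ltr0n // ler1n.
apply: lerD; apply: le_trans (cnormM _ _) _.
  by rewrite mulrC cnorm_sub ler_pM ?cnorm_ge0.
rewrite cnorm_sub ler_pM ?cnorm_ge0 //.
by rewrite /K -addrA lerDl addr_ge0 ?cnorm_ge0.
Qed.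

End Gauge.

(** * Infinitely many inequivalent structures *)

(** A matrix of rank one has determinant zero, and the 2 x 2 identity has not. *)
Lemma rank_one_not_near_identity (K : numFieldType) (b0 b1 x y : K) :
  `|b0 * x - 1| < 2^-1 -> `|b0 * y| < 2^-1 ->
  `|b1 * x| < 2^-1 -> `|b1 * y - 1| < 2^-1 -> False.
Proof.
have big z : `|z - 1| < 2^-1 :> K -> 2^-1 < `|z|.
  move=> z1; have : `|1 : K| < `|z| + 2^-1.
    by rewrite -{1}(subKr z 1) (le_lt_trans (ler_normB _ _)) // ltrD2l.
  by rewrite normr1 {1}(splitr 1) div1r ltrD2r.
move=> /(big _) X U V /(big _) Y.
have : `|b0 * y| * `|b1 * x| < `|b0 * x| * `|b1 * y|.
  by apply: (@lt_trans _ _ (2^-1 * 2^-1)); apply: ltr_pM => //;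
    rewrite invr_ge0 ler0n.
by rewrite -!normrM (_ : b0 * y * (b1 * x) = b0 * x * (b1 * y)) ?ltxx //; ring.
Qed.

Section Final.
Variables (R : realType) (q : R).
Hypothesis q01 : 0 < q < 1.
Let q0 : 0 < q. Proof. by case/andP: q01. Qed.
Let q1 : q < 1. Proof. by case/andP: q01. Qed.
Local Notation C := R[i].
Local Notation Q := (q%:C).
Local Notation SU := (suq2 q).
Local Notation CP := (@CP R q).
Local Notation Lset := (@Lset R q).

(** The bound K serves all x, so that x may run through a sequence. *)
Lemma entryM_column y j : exists K, forall (x : SU) i,
  entry (x * y) i j = \sum_(k < K) entry y k j * entry x i k.
Proof.
have [K HK] := entry_column y j; exists K => x i.
rewrite -act_sum /entry actM //; congr (act x _ i); apply/funext => l.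
have [lK|Kl] := ltnP l K.
  rewrite (bigD1 (Ordinal lK)) //= /basis eqxx mulr1 big1 ?addr0 //.
  by move=> k; rewrite -val_eqE /= eq_sym => /negPf ->; rewrite mulr0.
rewrite [LHS]HK // big1 // => k _; rewrite /basis gtn_eqF ?mulr0 //.
exact: leq_trans (ltn_ord k) Kl.
Qed.

(** The factor q^(-2k) makes the weights of x - theta k vanish at k. *)
Definition theta_weight k : C := kappa q * Q ^- (2 * k).

Definition theta k : Omega q := toL (-2) (theta_weight k *: (qc q * qa q)).

Lemma theta_val k : Lval (theta k) = theta_weight k *: (qc q * qa q).
Proof.
apply: toLE; apply: Lset_scale; apply: (@Lset_holo _ _ q0 (-1)); first by right.
by apply: Lset_holo1 => //; left.
Qed.

Definition theta_shift k i : C := theta_weight k * (Q ^+ i * weight q i.+1).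

Lemma theta_form k : shift_form (Lval (theta k)) (theta_shift k).
Proof.
by move=> v i; rewrite theta_val actZ // actM // !act_gen // /theta_shift !mulrA.
Qed.

(** The bundle L_n contains a power of c or of star c, which acts as an invertible
    diagonal matrix. *)
Lemma shift_form_unique n (theta1 : Omega q) k :
  @nabla_ R q n theta1 =1 nabla_ (theta k) ->
  shift_form (Lval theta1) (theta_shift k).
Proof.
move=> E v i; rewrite -theta_form.
have Q0 m : Q ^+ m != 0 by rewrite expf_neq0 // qC_neq0.
suff [x Lx [l l0 xl]] : exists2 x : SU, Lset n x & exists2 l : C, l != 0 &
    forall w, act x w i = l * w i.
  have /(congr1 (fun y => act y v i)) := nabla_mul_eq q0 E (toL n x).
  by rewrite toLE // !actM // !xl => /(mulfI l0).
have XE (x : SU) m : (forall w j, act x w j = Q ^+ j * w j) ->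
    forall w, act (x ^+ m) w i = (Q ^+ i) ^+ m * w i.
  move=> xE; elim: m => [|m IH] w; first by rewrite !expr0 mul1r act1.
  by rewrite exprSr actM // IH xE mulrA exprSr.
case: n {E} => m.
  exists (star (qc q) ^+ m); last first.
    by exists ((Q ^+ i) ^+ m); [rewrite -exprM|apply: XE; apply: act_c'].
  apply: Lset_gen; apply/L_gens_pos; exists m; first exact: leqnn.
  by rewrite subnn expr0 mulr1.
exists (qc q ^+ m.+1); last first.
  by exists ((Q ^+ i) ^+ m.+1); [rewrite -exprM|apply: XE; apply: act_c].
apply: Lset_gen; apply/(L_gens_neg m.+1); exists m.+1; first exact: leqnn.
by rewrite subnn expr0 mulr1.
Qed.

Definition weight_diff k i : C := coord_weight q i - theta_shift k i.

Lemma weight_diffE k i : weight_diff k i =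
  kappa q * weight q i.+1 * Q ^- i * Q ^- (2 * k) * (Q ^+ (2 * k) - Q ^+ (2 * i)).
Proof.
have P m : Q ^+ m != 0 by rewrite expf_neq0 // qC_neq0.
rewrite /weight_diff /coord_weight /theta_shift /theta_weight.
rewrite [Q ^+ (2 * i)](_ : _ = Q ^+ i * Q ^+ i); last by rewrite -exprD addnn mul2n.
by field; rewrite !P.
Qed.

Lemma weight_diff_eq0 k : weight_diff k k = 0.
Proof. by rewrite weight_diffE subrr mulr0. Qed.

Lemma weight_diff_neq0 k i : i != k -> weight_diff k i != 0.
Proof.
move=> ik; have P m : Q ^+ m != 0 by rewrite expf_neq0 // qC_neq0.
have D : Q ^+ (2 * k) - Q ^+ (2 * i) != 0.
  rewrite subr_eq0 -!rmorphXn (inj_eq (fmorph_inj _)); apply: contra ik => /eqP E.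
  have := ieexprIn q0 _ E.
  by rewrite (lt_eqF q1) => /(_ isT) /eqP; rewrite eqn_mul2l /= eq_sym.
have W := weightS_neq0 q01 i; have K0 := kappa_neq0 q01.
rewrite weight_diffE; move: (kappa q) K0 => K K0.
by rewrite !mulf_eq0 !invr_eq0 !negb_or W K0 !P D.
Qed.

Lemma theta_shift_inj k l : theta_shift k =1 theta_shift l -> k = l.
Proof.
move=> E; apply/eqP/negPn/negP => kl; have := weight_diff_neq0 kl.
by rewrite /weight_diff -E -[_ - _]/(weight_diff k k) weight_diff_eq0 eqxx.
Qed.

Variables (A : cstarAlgType R) (a c : A).
Hypothesis rel : suq2_rel q a c.
Variable h : A -> C.
Hypothesis haar : haar_state q a c h.
Variables (H : completeNormedModType C) (ip : H -> H -> C) (Lam : A -> H).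
Hypothesis L2 : gns h ip Lam.

(** If k2 < k1, row k1 of g vanishes, against g g' = 1. If k1 < k2, columns 0 and
    k2 + 1 of g are both supported in row k1 + 1, so that a 2 x 2 block of g' g
    has rank one. *)
Lemma no_intertwiner (g g' : A) (p p' : nat -> SU) (k1 k2 : nat) (t1 t2 : nat -> C) :
  g * g' = 1 -> g' * g = 1 -> approx a c g p -> approx a c g' p' ->
  (forall i, i != k1 -> t1 i != 0) -> (forall i, i != k2 -> t2 i != 0) ->
  t1 k1 = 0 -> t2 k2 = 0 ->
  (forall i, null (fun n => t1 i * entry (p n) i.+1 0)) ->
  (forall i j, null (fun n => t2 j * entry (p n) i j - t1 i * entry (p n) i.+1 j.+1)) ->
  k1 = k2.
Proof.
move=> gg' g'g gp g'p' t1n t2n t10 t20 col diag; apply/eqP.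
pose u i j n := entry (p n) i j.
have e4 : 0 < 4^-1 :> C by rewrite invr_gt0.
case: ltngtP => // k12; exfalso.
- have cols := null_columns (u := u) t1n t2n t10 t20 col diag k12.
  have P i j := approx_product q01 rel haar L2 i j g'g g'p' gp e4.
  have [N1 H1] := P 0%N 0%N; have [N2 H2] := P 0%N k2.+1.
  have [N3 H3] := P k2.+1 0%N; have [N4 H4] := P k2.+1 k2.+1.
  pose m := maxn (maxn N1 N2) (maxn N3 N4).
  have [m1 m2 m3 m4] : [/\ (N1 <= m)%N, (N2 <= m)%N, (N3 <= m)%N & (N4 <= m)%N].
    by split; rewrite /m; lia.
  have L i j : (forall l, l != k1.+1 -> null (u l j)) -> exists N, forall n, (N <= n)%N ->
      `|entry (p' m * p n) i j - entry (p' m) i k1.+1 * u k1.+1 j n| < 4^-1.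
    move=> nu; have [K0 HK] := act_entries (p' m) i.
    have kK : (k1.+1 < maxn K0 k1.+2)%N by rewrite leq_maxr.
    have nl : null (fun n => entry (p' m * p n) i j - entry (p' m) i k1.+1 * u k1.+1 j n).
      apply: (null_eq (x := fun n => \sum_(k < maxn K0 k1.+2 | k != Ordinal kK)
          entry (p' m) i k * u k j n)).
        move=> n; rewrite {2}/entry actM // (HK _ (leq_maxl K0 k1.+2)).
        by rewrite [in RHS](bigD1 (Ordinal kK)) //= [X in _ = X - _]addrC addrK.
      under eq_fun do rewrite big_mkcond.
      apply: null_sum => k; case: eqP => [_|/eqP]; first exact: null0.
      by rewrite -val_eqE => kk; apply: nullM; apply: nu.
    exact: nl.
  have [L1 L2'] : (forall l, l != k1.+1 -> null (u l 0%N)) /\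
      (forall l, l != k1.+1 -> null (u l k2.+1)).
    by split=> l /cols [].
  have [M1 G1] := L 0%N _ L1; have [M2 G2] := L 0%N _ L2'.
  have [M3 G3] := L k2.+1 _ L1; have [M4 G4] := L k2.+1 _ L2'.
  pose n := maxn m (maxn (maxn M1 M2) (maxn M3 M4)).
  have [n0 n1 n2 n3 n4] : [/\ (m <= n)%N, (M1 <= n)%N, (M2 <= n)%N, (M3 <= n)%N & (M4 <= n)%N].
    by split; rewrite /n; lia.
  have near (x y z : C) : `|x - y| < 4^-1 -> `|x - z| < 4^-1 -> `|z - y| < 2^-1.
    move=> xy xz; rewrite -(subrKA x) (le_lt_trans (ler_normD _ _)) // distrC.
    by rewrite [2^-1](_ : _ = 4^-1 + 4^-1) ?ltrD //; field.
  have := near _ _ _ (H4 _ _ m4 (leq_trans m4 n0)) (G4 _ n4).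
  have := near _ _ _ (H3 _ _ m3 (leq_trans m3 n0)) (G3 _ n3).
  have := near _ _ _ (H2 _ _ m2 (leq_trans m2 n0)) (G2 _ n2).
  have := near _ _ _ (H1 _ _ m1 (leq_trans m1 n0)) (G1 _ n1).
  rewrite /= !eqxx !subr0.
  exact: rank_one_not_near_identity.
have row := null_row (u := u) t1n t2n t10 col diag k12.
have [N HN] := approx_product q01 rel haar L2 k1 k1 gg' gp g'p' e4.
have [K HK] := entryM_column (p' N) k1.
have nl : null (fun n => entry (p n * p' N) k1 k1).
  apply: (null_eq (x := fun n => \sum_(k < K) entry (p' N) k k1 * u k1 k n)).
    by move=> n; rewrite HK.
  by apply: null_sum => k; apply: nullM; apply: row.
have [M HM] := nl _ e4.
have := HN (maxn N M) N (leq_maxl _ _) (leqnn _); rewrite eqxx.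
have := HM (maxn N M) (leq_maxr _ _).
set z := entry _ _ _ => z1 z2.
have : `|1 : C| < 4^-1 + 4^-1.
  by rewrite -{1}(subKr z 1) (le_lt_trans (ler_normB _ _)) // ltrD.
rewrite normr1 (_ : 4^-1 + 4^-1 = 2^-1); last by field.
by rewrite invf_gt1 ?ltr0n // ltrn1.
Qed.

End Final.

Theorem theorem1p3 (R : realType) (q : R) (q01 : 0 < q < 1)
    (A : cstarAlgType R) (a c : A) (univ : universal_suq2 q a c)
    (h : A -> R[i]) (haar : haar_state q a c h)
    (H : completeNormedModType R[i]) (ip : H -> H -> R[i]) (Lam : A -> H)
    (L2 : gns h ip Lam) (n : int) :
  exists S : set (holomorphic_structure q n),
    infinite_set S /\
    forall N1 N2, S N1 -> S N2 -> N1 <> N2 ->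
      ~ gauge_equivalent a c Lam N1 N2.
Proof.
have q0 : 0 < q by case/andP: q01.
have rel : suq2_rel q a c by case: univ.
have [N NE] := choice (fun k => holomorphic_nabla q0 n (theta q k)).
exists (range N); split.
  have Ninj : injective N.
    move=> k l Nkl; apply: (theta_shift_inj q01) => i.
    have F : shift_form (Lval (theta q k)) (theta_shift q l).
      apply: (shift_form_unique q01 (n := n)) => s.
      by rewrite -!NE Nkl.
    by have := F (fun=> 1) i; rewrite (theta_form q01) !mulr1.
  move=> /(finite_preimage (B := range N) (f := N)) fin.
  apply: infinite_nat; apply: sub_finite_set (fin _); last by move=> k l _ _ /Ninj.
  by move=> k _; exists k.
move=> _ _ [k1 _ <-] [k2 _ <-] N12 [theta1 [theta2 [E1 E2 [g [g' []]]]]].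
move=> [Cg Cg' gg' g'g] [_ _ graph].
apply: N12; congr N.
have F1 : shift_form (Lval theta1) (theta_shift q k1).
  by apply: (shift_form_unique q01 (n := n)) => s; rewrite -E1 NE.
have F2 : shift_form (Lval theta2) (theta_shift q k2).
  by apply: (shift_form_unique q01 (n := n)) => s; rewrite -E2 NE.
have [p gp] := approx_exists q01 rel Cg.
have [p' g'p'] := approx_exists q01 rel Cg'.
have [col diag] := graph_recursion q01 rel haar L2 gp graph F1 F2.
exact: (no_intertwiner q01 rel haar L2 gg' g'g gp g'p' (weight_diff_neq0 q01 (k := k1))
  (weight_diff_neq0 q01 (k := k2)) (weight_diff_eq0 q01 k1) (weight_diff_eq0 q01 k2) col diag).
Qed.
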